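(* Let $n>m$. The metric completion of the space $M_+(n,m)$ with respect to the geodesic distance $\operatorname{dist}^{n\times m}$ of the Riemannian metric $\langle u,v\rangle_a=\operatorname{tr}(u(a^Ta)^{-1}v^T)\sqrt{\det(a^Ta)}$ is given by $M(n,m)/\!\sim$, where $a\sim b$ if $\operatorname{rank}(a)<m$ and $\operatorname{rank}(b)<m$ (so full-rank matrices represent themselves, and all matrices of rank less than $m$ are identified to a single point).
   Context: $M(n,m)$ is the space of all real $n\times m$ matrices and $M_+(n,m)\subset M(n,m)$ is the open subset of matrices of rank $m$. The geodesic distance is $$\operatorname{dist}^{n\times m}(a_0,a_1)=\inf_a\int_0^1\sqrt{\langle a_t(t),a_t(t)\rangle_{a(t)}}\,dt,$$ the infimum being over all piecewise differentiable $a:[0,1]\to M_+(n,m)$ with $a(0)=a_0$, $a(1)=a_1$. *)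

(* Defs.v *)
From HB Require Import structures.
From mathcomp Require Import all_boot all_order all_algebra generic_quotient.
From mathcomp Require Import all_classical all_reals all_analysis.

Set Implicit Arguments.
Unset Strict Implicit.
Unset Printing Implicit Defensive.

Import Order.TTheory GRing.Theory Num.Theory.
Import numFieldNormedType.Exports.

Local Open Scope classical_set_scope.
Local Open Scope ring_scope.

Section GeodesicDistance.
Context {R : realType} {n m : nat}.

Definition full_rank_mx := {a : 'M[R]_(n, m) | \rank a == m}.

Definition riem_metric (a u v : 'M[R]_(n, m)) : R :=
  \tr (u *m invmx (a^T *m a) *m v^T) * Num.sqrt (\det (a^T *m a)).

(* [itv_partition 0 1 s] says that 0 :: s is strictly increasing and ends at 1.
   A curve is differentiable on a closed piece (one-sidedly at its endpoints)
   iff it coincides there with a function that is derivable at every point of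
   the piece. Consecutive pieces share an endpoint, so these curves are
   continuous on [0, 1]. *)
Definition piecewise_differentiable (a : R -> 'M[R]_(n, m)) : Prop :=
  exists2 s : seq R, itv_partition 0 1 s &
    forall i, (i < size s)%N ->
      let I := `[nth 0 (0 :: s) i, nth 0 s i] in
      exists2 b : R -> 'M[R]_(n, m),
        {in I, a =1 b} & {in I, forall t, derivable b t 1}.

(* The values of a outside [0, 1] are irrelevant: they can only affect the
   derivative at the two endpoints. *)
Definition admissible_curve (a0 a1 : 'M[R]_(n, m)) (a : R -> 'M[R]_(n, m)) :=
  [/\ piecewise_differentiable a,
      {in `[0, 1], forall t, \rank (a t) = m},
      a 0 = a0 & a 1 = a1].

(* A Lebesgue integral of a nonnegative function, possibly +oo; derive1 takes
   an irrelevant value at the finitely many break points. *)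
Definition curve_length (a : R -> 'M[R]_(n, m)) : \bar R :=
  (\int[lebesgue_measure]_(t in `[0%R, 1%R])
    (Num.sqrt (riem_metric (a t) (derive1 a t) (derive1 a t)))%:E)%E.

Definition geodesic_dist (a0 a1 : 'M[R]_(n, m)) : \bar R :=
  ereal_inf [set curve_length a | a in admissible_curve a0 a1].

Definition collapse (a b : 'M[R]_(n, m)) : bool :=
  (a == b) || ((\rank a < m)%N && (\rank b < m)%N).

Lemma collapse_refl : reflexive collapse.
Proof. by move=> a; rewrite /collapse eqxx. Qed.

Lemma collapse_sym : symmetric collapse.
Proof. by move=> a b; rewrite /collapse eq_sym andbC. Qed.

Lemma collapse_trans : transitive collapse.
Proof.
move=> b a c /orP[/eqP->//|/andP[ra rb]] /orP[/eqP<-|/andP[_ rc]].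
  by rewrite /collapse ra rb orbT.
by rewrite /collapse ra rc orbT.
Qed.

Definition collapse_equiv : equiv_rel 'M[R]_(n, m) :=
  EquivRel collapse collapse_refl collapse_sym collapse_trans.

Definition collapsed_mx := {eq_quot collapse_equiv}%qT.
HB.instance Definition _ := Choice.on collapsed_mx.
HB.instance Definition _ := EqQuotient.on collapsed_mx.

Definition full_rank_class (a : full_rank_mx) : collapsed_mx :=
  (\pi_collapsed_mx (val a))%qT.

End GeodesicDistance.

Arguments full_rank_mx : clear implicits.
Arguments collapsed_mx : clear implicits.

Definition complete_space (T : uniformType) : Prop :=
  forall F : set_system T, ProperFilter F -> cauchy F -> exists l : T, F --> l.

(* T, with the embedding i, is the metric completion of (X, d). That d is a
   finite metric on X is a consequence if i is injective. *)
Definition is_metric_completion {R : realType} (X : Type)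
    (d : X -> X -> \bar R) (T : metricType R) (i : X -> T) : Prop :=
  [/\ forall x y, (mdist (i x) (i y))%:E = d x y,
      dense (range i) &
      complete_space T].

(* Main.v *)
From HB Require Import structures.
Require Import Defs.
From mathcomp Require Import all_boot all_order all_algebra generic_quotient.
From mathcomp Require Import all_classical all_reals all_analysis.
From mathcomp Require Import perm measurable_realfun ring lra.

Set Implicit Arguments.
Unset Strict Implicit.
Unset Printing Implicit Defensive.

Import Order.TTheory GRing.Theory Num.Theory.
Import numFieldNormedType.Exports.

Local Open Scope classical_set_scope.
Local Open Scope ring_scope.

(** Write g = a^T a and vol a = sqrt (det g), let |.| be the Frobenius norm, and
put rho a = (2 / sqrt m) * sqrt (vol a) for m > 0 ([collapse_radius]); for m = 0
there is a single matrix.  A velocity u at a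
full-rank matrix a factors as u = p a with p = u g^-1 a^T ([lifted_velocity]),
and the Riemannian square norm of u is |p|^2 * vol a.

The proof rests on rho, which is the distance to the collapsed point.
- By Jacobi's formula the derivative of sqrt (vol a) along a curve is
  sqrt (vol a) * tr p / 2.  As p is unchanged by right multiplication by the
  orthogonal projection onto the column space of a, which has norm sqrt m,
  |tr p| <= sqrt m * |p|.  Hence rho is 1-Lipschitz
  ([collapse_radius_lipschitz]).
- The ray from a to 0 has length rho a ([radial_curve]).  Going down the ray of
  a, across on a scaled copy of some curve from a to b, whose length tends to 0
  with the scale, and up the ray of b, gives dist a b <= rho a + rho b
  ([dist_le_radius]).  A curve from a to b is available because full-rank
  matrices are connected when m < n ([connect_full_rank], [dist_lty]).
These two bounds say exactly that dist, extended by |rho a - rho b| to pairs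
with a singular member, satisfies the triangle inequality on the quotient.

For completeness, consider a Cauchy filter.  If rho tends to 0 along it, it
converges to the collapsed point.  Otherwise rho stays bounded below, and there
|u| <= |p| |a| bounds the derivative of log |a| by a multiple of the speed, so
that differences of entries are at most a constant times the geodesic distance
([local_coord_bound]).  The filter is then Cauchy for the entries; its limit l
has rho l > 0, that is, full rank, and matrices with entries close to those of
l are geodesically close to l ([dist_near]).  The comparison of entries also
shows that distinct full-rank matrices have positive distance.

Each lower bound on a length integrates a bound |(f o c)'| <= speed along a
curve c that is differentiable off a finite set, with a derivative that need
not be bounded.  This is [increment_le_integral]: the increment of a continuous
function, differentiable off a finite set, is at most the integral of the
absolute value of its derivative.  The speed itself is treated as an arbitrary
nonnegative function: its integral is the supremum of the integrals of the
simple functions below it, and this lower integral is monotone, subadditive in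
the domain, and obeys affine changes of variable. *)

(** * Lower integrals of nonnegative functions *)

Section LowerIntegral.
Context d (T : measurableType d) (R : realType).
Variable mu : {measure set T -> \bar R}.
Local Open Scope ereal_scope.
Import HBNNSimple.

Lemma le_lower_integral (D E : set T) (f g : T -> \bar R) :
  (forall x, D x -> 0 <= f x) -> (forall x, E x -> 0 <= g x) ->
  (forall x, (f \_ D) x <= (g \_ E) x) ->
  \int[mu]_(x in D) f x <= \int[mu]_(x in E) g x.
Proof.
move=> f0 g0 fg; rewrite !ge0_integralE// ge_ereal_sup// => _ [h/= hf] <-.
by apply: ereal_sup_ubound; exists h => //= x; exact: le_trans (hf x) (fg x).
Qed.

(** A lower integral is bounded by bounding the measurable functions below its
integrand; every later inequality is first shown for those. *)
Lemma lower_integral_le (D : set T) (f : T -> \bar R) (y : \bar R) :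
  (forall x, D x -> 0 <= f x) ->
  (forall h : T -> R, measurable_fun setT h -> (forall x, (0 <= h x)%R) ->
     (forall x, (h x)%:E <= (f \_ D) x) -> \int[mu]_x (h x)%:E <= y) ->
  \int[mu]_(x in D) f x <= y.
Proof.
move=> f0 H; rewrite ge0_integralE// ge_ereal_sup// => _ [h/= hf] <-.
by rewrite -integralT_nnsfun; apply: H => // x; exact: fun_ge0.
Qed.

Lemma ge0_le_lower_integral (D : set T) (f g : T -> \bar R) :
  (forall x, D x -> 0 <= f x) -> (forall x, D x -> f x <= g x) ->
  \int[mu]_(x in D) f x <= \int[mu]_(x in D) g x.
Proof.
move=> f0 fg; apply: le_lower_integral => // [x Dx|x].
  exact: le_trans (f0 _ Dx) (fg _ Dx).
by rewrite !patchE; case: ifPn => //; rewrite inE; exact: fg.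
Qed.

Lemma lower_integral_setU_le (A B : set T) (f : T -> \bar R) : measurable A ->
  (forall x, (A `|` B) x -> 0 <= f x) ->
  \int[mu]_(x in A `|` B) f x <= \int[mu]_(x in A) f x + \int[mu]_(x in B) f x.
Proof.
move=> mA f0; apply: lower_integral_le => // h mh h0 hf.
have mEh : measurable_fun setT (EFin \o h) by exact/measurable_EFinP.
have -> : \int[mu]_x (h x)%:E = \int[mu]_(x in A) (h x)%:E + \int[mu]_(x in ~` A) (h x)%:E.
  rewrite -ge0_integral_setU//= ?setUv//; first exact: measurableC.
    by move=> x _; rewrite lee_fin.
  by apply/disj_set2P; exact: setICr.
have hx x : A x \/ B x -> (h x)%:E <= f x.
  by move=> ABx; have := hf x; rewrite patchE mem_set.
apply: leeD; apply: le_lower_integral => [x _|x Dx|x]; rewrite ?lee_fin//.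
- by apply: f0; left.
- rewrite !patchE; case: ifPn => //; rewrite inE => Ax.
  by apply: hx; left.
- by apply: f0; right.
- have [Bx|nBx] := pselect (B x).
    by rewrite !patchE (mem_set Bx); case: ifPn => _; [apply: hx|apply: f0]; right.
  rewrite !patchE (memNset nBx); case: ifPn => //; rewrite inE => nAx.
  by have := hf x; rewrite patchE memNset// => -[].
Qed.
End LowerIntegral.

Section LowerIntegralScale.
Context d (T : measurableType d) (R : realType).
Variable mu : {measure set T -> \bar R}.

Lemma lower_integralZl_le (D : set T) (k : R) (f : T -> R) : 0 < k ->
  (forall x, 0 <= f x) ->
  (\int[mu]_(x in D) (k * f x)%:E <= k%:E * \int[mu]_(x in D) (f x)%:E)%E.
Proof.
move=> k0 f0; apply: lower_integral_le => [x _|h mh h0 hf].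
  by rewrite lee_fin mulr_ge0// ltW.
have -> : (\int[mu]_x (h x)%:E = k%:E * \int[mu]_x (k^-1 * h x)%:E)%E.
  rewrite -ge0_integralZl//; last 3 first.
  - by apply/measurable_EFinP; exact: measurable_funM.
  - by move=> x _; rewrite lee_fin mulr_ge0// invr_ge0 ltW.
  - by rewrite lee_fin ltW.
  by apply: eq_integral => x _; rewrite -EFinM mulrA mulfV ?mul1r// gt_eqF.
rewrite lee_wpmul2l ?lee_fin ?(ltW k0)//.
apply: le_lower_integral => [x _|x _|x]; rewrite ?lee_fin//.
  by rewrite mulr_ge0// invr_ge0 ltW.
rewrite patch_setT; have := hf x; rewrite !patchE; case: ifPn => _; rewrite !lee_fin.
  by rewrite ler_pdivrMl.
by rewrite pmulr_rle0// invr_gt0.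
Qed.
End LowerIntegralScale.

Section AffineChange.
Context {R : realType}.
Notation mu := (@lebesgue_measure R).

(** Both sides are measures in [A] that agree on half-open intervals. *)
Lemma lebesgue_measure_affine (al be : R) (A : set R) : al != 0 -> measurable A ->
  (mu A = `|al|%:E * mu ((fun t => al * t + be)%R @^-1` A))%E.
Proof.
move=> al0 mA.
pose phi (t : measurableTypeR R) : measurableTypeR R := al * t + be.
have mphi : measurable_fun setT phi.
  by apply: measurable_funD => //; apply: measurable_funM.
pose phim : {mfun measurableTypeR R >-> measurableTypeR R} :=
  HB.pack phi (isMeasurableFun.Build _ _ _ _ _ mphi).
have nal : 0 <= `|al| by [].
rewrite [LHS](@lebesgue_measure_unique _ (mscale (NngNum nal) (pushforward mu phim))) //.
move=> _ [[a b]] _ <-.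
suff : mu `]a, b]%classic = (`|al|%:E * mu (phi @^-1` `]a, b]%classic))%E by [].
have -> : phi @^-1` `]a, b]%classic =
  if 0 < al then `](a - be) / al, (b - be) / al]%classic
  else `[(b - be) / al, (a - be) / al[%classic.
  case: ifPn => [al_gt0|]; last rewrite -leNgt => al_le0.
    apply/seteqP; split=> t /=; rewrite !in_itv/= ltr_pdivrMr// ler_pdivlMr// /phi;
      by rewrite ltrBlDr lerBrDr mulrC.
  have al_lt0 : al < 0 by rewrite lt_neqAle al0.
  apply/seteqP; split=> t /=; rewrite !in_itv/= ltr_ndivlMr// ler_ndivrMr// /phi;
    by rewrite ltrBlDr lerBrDr mulrC andbC.
have [al_gt0|al_le0] := ltP 0 al.
  rewrite /= !lebesgue_measure_itv/= !lte_fin ltr_pM2r ?invr_gt0// ltrD2r.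
  case: ifPn => ab; last by rewrite mule0.
  by rewrite -!EFinD -EFinM gtr0_norm//; congr EFin; field.
have al_lt0 : al < 0 by rewrite lt_neqAle al0.
rewrite /= !lebesgue_measure_itv/= !lte_fin ltr_nM2r ?invr_lt0// ltrD2r.
case: ifPn => ab; last by rewrite mule0.
by rewrite -!EFinD -EFinM ltr0_norm//; congr EFin; field.
Qed.

Lemma ge0_integral_affine (al be : R) (k : R -> \bar R) : al != 0 ->
  measurable_fun [set: R] k -> (forall x, 0 <= k x)%E ->
  (\int[mu]_x k x = `|al|%:E * \int[mu]_x k (al * x + be)%R)%E.
Proof.
move=> al0 mk k0.
pose phi (t : measurableTypeR R) : measurableTypeR R := al * t + be.
have mphi : measurable_fun setT phi.
  by apply: measurable_funD => //; apply: measurable_funM.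
pose phim : {mfun measurableTypeR R >-> measurableTypeR R} :=
  HB.pack phi (isMeasurableFun.Build _ _ _ _ _ mphi).
have nal : 0 <= `|al| by [].
rewrite [LHS](@eq_measure_integral _ _ _ _ (mscale (NngNum nal) (pushforward mu phim))).
  rewrite ge0_integral_mscale//; congr (_ * _)%E.
  by rewrite ge0_integral_pushforward// preimage_setT.
by move=> A mA _; exact: (lebesgue_measure_affine be al0 mA).
Qed.

(** Change of variable for lower integrals, in the only form that lengths of
reparametrized curves need.  The countable set [S] absorbs the break points,
where velocities carry no information. *)
Lemma le_lower_integral_affine (al be : R) (S : set R) (D E : set R)
    (f g : R -> \bar R) : al != 0 -> countable S -> measurable D ->
  (forall x, D x -> 0 <= f x)%E -> (forall x, E x -> 0 <= g x)%E ->
  (forall t, D t -> ~ S t -> E (al * t + be) /\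
     (f t <= `|al|%:E * g (al * t + be)%R)%E) ->
  (\int[mu]_(x in D) f x <= \int[mu]_(x in E) g x)%E.
Proof.
move=> al0 cS mD f0 g0 H; apply: lower_integral_le => // h mh h0 hf.
have mS : measurable S by exact: countable_measurable.
pose k (t : R) : \bar R := (h t * \1_(~` S) t)%:E.
have mk : measurable_fun setT k.
  apply/measurable_EFinP/measurable_funM => //.
  exact/measurable_indic/measurableC.
have k0 t : (0 <= k t)%E by rewrite lee_fin mulr_ge0.
have -> : (\int[mu]_x (h x)%:E = \int[mu]_x k x)%E.
  apply: ge0_ae_eq_integral => //; first exact/measurable_EFinP.
    by move=> t _; rewrite lee_fin.
  exists S; split => //; first exact: countable_lebesgue_measure0.
  move=> t /=; apply: contra_notP => nS _; rewrite /k indicE mem_set ?mulr1//.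
have ial : al^-1 != 0 by rewrite invr_eq0.
rewrite (ge0_integral_affine (- be / al) ial)//.
rewrite -ge0_integralZl//; last first.
  apply: (measurableT_comp mk).
  by apply: measurable_funD => //; apply: measurable_funM.
apply: le_lower_integral => // [x _|x]; first by rewrite mule_ge0.
rewrite patch_setT /k.
set t := (al^-1 * x + - be / al).
have xE : x = al * t + be by rewrite /t; field.
rewrite xE.
have [Dt|nDt] := pselect (D t); last first.
  have -> : h t = 0.
    apply: le_anti; rewrite h0 andbT -lee_fin.
    by have := hf t; rewrite patchE memNset.
  rewrite mul0r mule0 /patch; case: ifPn => //; rewrite inE; exact: g0.
rewrite indicE; have [St|nSt] := pselect (S t).
  rewrite memNset; last by move=> /(_ St).
  rewrite mulr0 mule0 /patch; case: ifPn => //; rewrite inE; exact: g0.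
have [Et fg] := H t Dt nSt.
rewrite mem_set// mulr1 patchE mem_set//.
rewrite normfV lee_pdivrMl ?normr_gt0//.
apply: le_trans fg; apply: le_trans (hf t) _.
by rewrite patchE mem_set.
Qed.
End AffineChange.

(** * Increments and integrals of derivatives *)

Section FTC.
Context {R : realType}.
Notation mu := (@lebesgue_measure R).

(** The half of the Vitali-Caratheodory theorem used below.  Cut [D] into the
level sets [E k] of [w] of height [eta], cover [E k] by an open [U k] of almost
the same measure, and sum the functions equal to [k.+2 * eta] on [U k]: near a
point of [E k] the sum is at least [k.+2 * eta > w], and the total excess is small. *)
Lemma lsc_majorant (D : set R) (w : R -> R) (e : R) :
  measurable D -> (mu D < +oo)%E -> measurable_fun D w ->
  (forall t, D t -> 0 <= w t) -> 0 < e ->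
  exists u : R -> \bar R, [/\ measurable_fun setT u, (forall t, 0 <= u t)%E,
    (\int[mu]_t u t <= \int[mu]_(t in D) (w t)%:E + e%:E)%E &
    forall t, D t -> exists c, w t < c /\ \forall s \near t, (c%:E <= u s)%E].
Proof.
move=> mD Doo mw w0 e0.
pose eta := e / (4 * (fine (mu D) + 1)).
have muD0 : 0 <= fine (mu D) by rewrite fine_ge0.
have eta0 : 0 < eta by rewrite divr_gt0// mulr_gt0// ltr_wpDl.
pose E k := D `&` w @^-1` `[k%:R * eta, k.+1%:R * eta[%classic.
have mE k : measurable (E k) by exact: mw.
have muE k : (mu (E k) < +oo)%E.
  by apply: le_lt_trans Doo; apply: le_measure; [rewrite inE;
    exact: mE|rewrite inE|exact: subIsetl].
pose c (k : nat) := k.+2%:R * eta.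
have c0 k : 0 < c k by rewrite mulr_gt0.
(* the excess measure of U k is weighted by c k and must sum to e / 2 *)
pose del k := e / 2 / (2 ^ k.+1)%:R / c k.
have del0 k : 0 < del k by rewrite !divr_gt0// ltr0n expn_gt0.
have HU k := cid (lebesgue_regularity_outer (mE k) (muE k) (del0 k)).
pose U k := projT1 (HU k).
have oU k : open (U k) by have [] := projT2 (HU k).
have EU k : E k `<=` U k by have [] := projT2 (HU k).
have UE k : (mu (U k `\` E k) < (del k)%:E)%E by have [] := projT2 (HU k).
have mU k : measurable (U k) by exact: open_measurable.
have mterm k : measurable_fun setT (fun s => ((c k)%:E * (\1_(U k) s)%:E)%E).
  by apply: emeasurable_funM => //; apply/measurable_EFinP/measurable_indic.
have term0 k s : (0 <= (c k)%:E * (\1_(U k) s)%:E)%E.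
  by rewrite mule_ge0// lee_fin// ltW.
pose u (s : R) : \bar R := (\sum_(k <oo) (c k)%:E * (\1_(U k) s)%:E)%E.
have DE : D = \bigcup_k E k.
  apply/seteqP; split=> [t Dt|t [k _ []]//].
  have : 0 <= w t / eta by rewrite divr_ge0// ?w0// ltW.
  move=> /truncn_itv; rewrite ler_pdivlMr// ltr_pdivrMr// => tt.
  by exists (Num.truncn (w t / eta)) => //; split=> //=; rewrite in_itv/=.
exists u; split.
- apply: ge0_emeasurable_sum => //.
- by move=> t; apply: nneseries_ge0.
- rewrite /u integral_nneseries//.
  have step k : (\int[mu]_s ((c k)%:E * (\1_(U k) s)%:E) <=
      \int[mu]_(t in E k) (w t + 2 * eta)%:E + (e / 2 / (2 ^ k.+1)%:R)%:E)%E.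
    rewrite ge0_integralZl//; last 2 first.
      apply/measurable_EFinP/measurable_indic; exact: mU.
      by rewrite lee_fin ltW.
    have -> : (\int[mu]_x (\1_(U k) x)%:E = mu (U k))%E.
      by rewrite (@integral_indic _ _ _ mu setT measurableT _ (mU k)) setIT.
    have -> : mu (U k) = (mu (E k) + mu (U k `\` E k))%E.
      rewrite -[in LHS](setDUK (@EU k)) measureU//.
      - exact: mE.
      - exact: measurableD (mU k) (mE k).
      - by rewrite -subset0 => t [Et [_ nE]]; exact: nE.
    rewrite ge0_muleDr//.
    apply: leeD.
      rewrite -(@integral_cst _ _ _ mu _ (mE k)).
      apply: ge0_le_lower_integral => [t _|t [Dt]]; first by rewrite lee_fin ltW.
      rewrite /= in_itv/= lee_fin /c => /andP[H _].
      by rewrite -addn2 natrD mulrDl lerD2r.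
    rewrite -lee_pdivlMl// -EFinM.
    by apply: (le_trans (ltW (UE k))); rewrite lee_fin /del mulrC.
  apply: (@le_trans _ _ (\sum_(k <oo) (\int[mu]_(t in E k) (w t + 2 * eta)%:E +
      (e / 2 / (2 ^ k.+1)%:R)%:E))%E).
    by apply: lee_nneseries => // k _ _; apply: integral_ge0.
  apply: le_trans (epsilon_trick _ _ _) _.
  + move=> k; apply: integral_ge0 => t [Dt _]; rewrite lee_fin addr_ge0//; first exact: w0.
    by rewrite mulr_ge0// ltW.
  + by rewrite divr_ge0// ltW.
  rewrite -ge0_integral_bigcup//; last 3 first.
  + rewrite -DE; apply/measurable_EFinP; exact: measurable_funD.
  + by rewrite -DE => t Dt; rewrite lee_fin addr_ge0//; [exact: w0|rewrite mulr_ge0// ltW].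
  + apply/trivIsetP => i j _ _ ij; rewrite -subset0 => t [[_ +] [_ +]].
    rewrite /= !in_itv/= => /andP[a1 a2] /andP[b1 b2]; move: ij; apply/negP;
      rewrite negbK eqn_leq.
    have := le_lt_trans a1 b2; have := le_lt_trans b1 a2.
    by rewrite !ltr_pM2r// !ltr_nat !ltnS => -> ->.
  rewrite -DE.
  under eq_integral do rewrite EFinD.
  rewrite ge0_integralD//; last 2 first.
  + exact/measurable_EFinP.
  + by move=> t _; rewrite lee_fin mulr_ge0// ltW.
  rewrite integral_cst// -addeA leeD2l//.
  rewrite [X in (_ * X)%E](_ : _ = (fine (mu D))%:E); last by rewrite fineK// ge0_fin_numE.
  rewrite -EFinM -EFinD lee_fin /eta.
  rewrite -lerBrDr; have -> : e - e / 2 = e / 2 by field.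
  rewrite [X in X <= _](_ : _ = e / 2 * (fine (mu D) / (fine (mu D) + 1)));
    last by field; rewrite gt_eqF // ltr_wpDl.
  rewrite ler_piMr//; first by rewrite divr_ge0// ltW.
  by rewrite ler_pdivrMr ?mul1r ?lerDl// ltr_wpDl.
- move=> t; rewrite {1}DE => -[k _ Ekt]; exists (c k); split.
    case: Ekt => _ /=; rewrite in_itv/= => /andP[_] /lt_trans; apply.
    by rewrite /c ltr_pM2r// ltr_nat.
  have : nbhs t (U k) by apply: open_nbhs_nbhs; split=> //; exact: EU.
  apply: filterS => s Us; rewrite /u.
  rewrite (@nneseriesD1 _ _ k)//.
  by rewrite indicE mem_set// mule1 leeDl// nneseries_ge0.
Qed.

(** On the open interval the derivative is the limit of the difference quotients
of the extension of [f] by 0, which is measurable. *)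
Lemma measurable_derive1 (f : R -> R) (x y : R) (S : seq R) :
  {within `[x, y], continuous f} ->
  (forall t, t \in `]x, y[ -> t \notin S -> derivable f t 1) ->
  measurable_fun (`]x, y[ `\` [set` S]) (derive1 f).
Proof.
move=> cf df.
pose F := f \_ `[x, y].
have mF : measurable_fun [set: R] F.
  apply: (iffLR (measurable_restrictT f _)) => //;
    apply: subspace_continuous_measurable_fun => //.
pose q n (t : R) := n.+1%:R * (F (t + n.+1%:R^-1) - F t).
apply: (@measurable_fun_cvg _ _ _ _ q) => [n|t [txy tS]].
  apply: measurable_funTS; apply: measurable_funM => //.
  apply: measurable_funB => //; apply: (measurableT_comp mF).
  exact: measurable_funD.
move/negP: tS => /= tS; rewrite /= in_itv/= in txy.
have dft : derivable f t 1 by apply: df.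
apply/cvgrPdist_lt => e e0.
have : (fun h => h^-1 *: (f (h *: 1 + t) - f t)) @ 0^' --> 'D_1 f t by exact: dft.
move=> /cvgrPdist_lt/(_ e e0).
rewrite near_withinE => /nbhs_ballP[d /= d0 dH].
have yt0 : 0 < y - t by rewrite subr_gt0; case/andP: txy.
near=> n.
have nd : n.+1%:R^-1 < d.
  by near: n; exact: (cvgr_lt _ (@cvg_harmonic R)).
have ny : n.+1%:R^-1 < y - t.
  by near: n; exact: (cvgr_lt _ (@cvg_harmonic R)).
have n0 : 0 < n.+1%:R^-1 :> R by rewrite invr_gt0.
rewrite /q /F !patchE !mem_set/=; last 2 first.
- by rewrite in_itv/=; case/andP: txy => *; rewrite !ltW.
- rewrite in_itv/=; case/andP: txy => xt ty.
  by rewrite (le_trans (ltW xt)) ?lerDl ?(ltW n0)// -lerBrDl ltW.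
have := dH (n.+1%:R^-1).
rewrite /ball/= sub0r normrN gtr0_norm// => /(_ nd (lt0r_neq0 n0)).
by rewrite derive1E invrK /GRing.scale/= mulr1 [t + _]addrC.
Unshelve. all: by end_near. Qed.

Lemma count_lt_mono (s : seq R) (a b : R) : a < b -> a \in s ->
  (count (fun t => t < a)%R s < count (fun t => t < b)%R s)%N.
Proof.
move=> ab; elim: s => //= t s IH; rewrite inE => /orP[/eqP <-|/IH{}IH].
  rewrite ltxx ab add0n add1n ltnS; apply: sub_count => u /= /lt_trans; exact.
rewrite -addnS leq_add//; case: ltP => // ta.
by rewrite (lt_trans ta ab).
Qed.

(** Take a majorant [u] of [|f'|] as above and show [f z - f x <= G z], where
[G z] is the integral of [u] up to [z] plus [eta] for each exceptional point
passed.  The set of such [z] is closed under suprema since [f] is continuous and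
[G] nondecreasing, and it has no last point before [y]: just after an ordinary
point [u] exceeds the slope of [f], and just after an exceptional one [G] has
gained [eta]. *)
Lemma increment_le_integral (f : R -> R) (x y : R) (S : seq R) : x <= y ->
  {within `[x, y], continuous f} ->
  (forall t, t \in `]x, y[ -> t \notin S -> derivable f t 1) ->
  ((f y - f x)%:E <= \int[mu]_(t in `]x, y[ `\` [set` S]) `|derive1 f t|%:E)%E.
Proof.
move=> xy cf df.
set D := _ `\` _.
have mD : measurable D.
  apply: measurableD => //; apply: countable_measurable => //.
  by apply: finite_set_countable; exact: finite_seq.
have Doo : (mu D < +oo)%E.
  apply: (@le_lt_trans _ _ (mu `]x, y[)); last first.
    by rewrite /= lebesgue_measure_itv/=; case: ifP => // _; rewrite -EFinD ltry.
  by apply: le_measure; rewrite ?inE//; exact: subDsetl.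
have mw : measurable_fun D (fun t => `|derive1 f t|).
  by apply: measurableT_comp => //; exact: measurable_derive1.
apply/lee_addgt0Pr => e e0.
have e20 : 0 < e / 2 by rewrite divr_gt0.
have [u [mu_ u0 Iu uD]] := lsc_majorant mD Doo mw (fun t _ => normr_ge0 _) e20.
(* x is exceptional as well: f has a derivative only inside the interval *)
pose N := size (x :: S).
pose eta := e / 2 / N%:R.
have eta0 : 0 < eta by rewrite !divr_gt0// ltr0n.
pose cnt (z : R) := count (fun s => s < z) (x :: S).
have cnt_mono a b : a <= b -> (cnt a <= cnt b)%N.
  by move=> ab; apply: sub_count => s /= /lt_le_trans; exact.
have cntN z : (cnt z <= N)%N by exact: count_size.
pose G z := (\int[mu]_(t in `[x, z]) u t + (eta * (cnt z)%:R)%:E)%E.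
have G_mono a b : a <= b -> (G a <= G b)%E.
  move=> ab; apply: leeD; last by rewrite lee_fin ler_pM2l// ler_nat cnt_mono.
  apply: ge0_subset_integral => //; first exact: measurable_funTS.
  by apply: subset_itvl; rewrite bnd_simp.
pose P z := ((f z - f x)%:E <= G z)%E.
have G0 z : (0 <= G z)%E.
  rewrite adde_ge0 ?integral_ge0// lee_fin mulr_ge0// ltW//.
pose Z := [set z | z \in `[x, y] /\ P z].
have Zx : Z x by split; [rewrite in_itv/= lexx xy|rewrite /P subrr].
have supZ : has_sup Z.
  by split; [exists x|exists y => z [/[!in_itv]/= /andP[]]].
pose z := sup Z.
have xz : x <= z by exact: ub_le_sup supZ.2 _ Zx.
have zy : z <= y.
  by apply: ge_sup; [exists x|move=> t [/[!in_itv]/= /andP[]]].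
have zxy : z \in `[x, y] by rewrite in_itv/= xz.
have /subspace_continuousP/(_ z zxy) /cvgrPdist_lt cfz := cf.
have Pz : P z.
  rewrite /P; apply/lee_addgt0Pr => d d0.
  have := cfz _ d0; rewrite near_withinE => /nbhs_ballP[r /= r0 rH].
  have [z' [z'xy Pz'] z'z] := sup_adherent r0 supZ.
  have z'_le : z' <= z by exact: ub_le_sup supZ.2 _ (conj z'xy Pz').
  have /rH/(_ z'xy) : ball z r z'.
    by rewrite /ball/= ger0_norm ?subr_ge0// ltrBlDr -ltrBlDl.
  move=> /ltr_normlP[_]; rewrite ltrBlDr => fz.
  apply: (@le_trans _ _ ((f z' - f x)%:E + d%:E)%E).
    by rewrite -EFinD lee_fin -addrA [- f x + _]addrC addrA lerD2r addrC ltW.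
  by rewrite leeD2r// (le_trans Pz')// G_mono.
have zE : z = y.
  apply: contrapT => /eqP zNy; have zy' : z < y by rewrite lt_neqAle zNy.
  suff [s [zs sy Ps]] : exists s, [/\ z < s, s <= y & P s].
    suff : s <= z by rewrite leNgt zs.
    apply: ub_le_sup; [exact: supZ.2|split=> //].
    by rewrite in_itv/= sy (le_trans xz) ?ltW.
  have [zS|zS] := boolP (z \in x :: S).
    have := cfz _ eta0; rewrite near_withinE => /nbhs_ballP[r /= r0 rH].
    pose h := Num.min (r / 2) (y - z).
    have h0 : 0 < h by rewrite lt_min divr_gt0//= subr_gt0.
    have hy : z + h <= y by rewrite -lerBrDl ge_min lexx orbT.
    exists (z + h); split => //; first by rewrite ltrDl.
    have : `|f z - f (z + h)| < eta.
      apply: rH; last by rewrite /= in_itv/= hy (le_trans xz)// lerDl ltW.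
      rewrite /ball/= opprD addrA subrr sub0r normrN gtr0_norm//.
      by rewrite gt_min ltr_pdivrMr// ltr_pMr// ltr1n.
    move=> /ltr_normlP[]; rewrite opprB ltrBlDr => fz _.
    have cntS : (cnt z < cnt (z + h)%R)%N by apply: count_lt_mono => //; rewrite ltrDl.
    rewrite /P; apply: (@le_trans _ _ ((f z - f x)%:E + eta%:E)%E).
      by rewrite -EFinD lee_fin -addrA [- f x + _]addrC addrA lerD2r addrC ltW.
    apply: (le_trans (leeD2r _ Pz)); rewrite /G -addeA -EFinD -{2}(mulr1 eta) -mulrDr.
    apply: leeD; last by rewrite lee_fin ler_pM2l// -(natrD _ _ 1) ler_nat addn1.
    apply: ge0_subset_integral => //; first exact: measurable_funTS.
    by apply: subset_itvl; rewrite bnd_simp lerDl ltW.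
  move: zS; rewrite inE negb_or => /andP[zNx zS].
  have xz' : x < z by rewrite lt_neqAle eq_sym zNx.
  have zxy' : z \in `]x, y[ by rewrite in_itv/= xz'.
  have Dz : D z by split => //=; apply/negP.
  have [c [wc /nbhs_ballP[r1 /= r10 r1H]]] := uD _ Dz.
  have : (fun h => h^-1 *: (f (h *: 1 + z) - f z)) @ 0^' --> 'D_1 f z by exact: df.
  have cw : 0 < c - `|derive1 f z| by rewrite subr_gt0.
  move=> /cvgrPdist_lt/(_ _ cw).
  rewrite near_withinE => /nbhs_ballP[r2 /= r20 r2H].
  pose h := Num.min (Num.min (r1 / 2) (r2 / 2)) (y - z).
  have h0 : 0 < h by rewrite !lt_min !divr_gt0//= subr_gt0.
  have hy : z + h <= y by rewrite -lerBrDl ge_min lexx orbT.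
  have hr1 : h < r1 by rewrite !gt_min ltr_pdivrMr// ltr_pMr// ltr1n.
  have hr2 : h < r2 by rewrite !gt_min ltr_pdivrMr// [X in _ || X || _]ltr_pdivrMr//
    !ltr_pMr// !ltr1n orbT.
  exists (z + h); split => //; first by rewrite ltrDl.
  have fh : f (z + h) - f z <= c * h.
    have := r2H h; rewrite /ball/= sub0r normrN gtr0_norm// => /(_ hr2 (lt0r_neq0 h0)).
    rewrite -derive1E /GRing.scale/= mulr1 [h + _]addrC distrC => /ltr_normlP[_].
    rewrite ltrBlDr => H.
    have {H} : h^-1 * (f (z + h) - f z) <= c.
      by rewrite ltW// (lt_le_trans H)// -lerBrDr lerD2l lerN2 ler_norm.
    by rewrite ler_pdivrMl// mulrC.
  rewrite /P; apply: (@le_trans _ _ ((f z - f x)%:E + (c * h)%:E)%E).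
    by rewrite -EFinD lee_fin -addrA [- f x + _]addrC addrA lerD2r addrC -lerBlDr.
  apply: (le_trans (leeD2r _ Pz)); rewrite /G addeAC.
  apply: leeD; last by rewrite lee_fin ler_pM2l// ler_nat cnt_mono// lerDl ltW.
  have -> : `[x, z + h]%classic = `[x, z]%classic `|` `]z, z + h]%classic.
    by rewrite -itv_bndbnd_setU// bnd_simp// lerDl ltW.
  rewrite ge0_integral_setU//=; last 2 first.
  - exact: measurable_funTS.
  - apply/disj_set2P; rewrite -subset0 => t [] /=; rewrite !in_itv/=.
    by move=> /andP[_ a] /andP[b _]; have := lt_le_trans b a; rewrite ltxx.
  rewrite leeD2l//.
  apply: (@le_trans _ _ (\int[mu]_(t in `]z, (z + h)%R]) (cst c%:E) t)%E).
    rewrite integral_cst//= lebesgue_measure_itv/= lte_fin ltrDl h0 -EFinD -EFinM.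
    by rewrite addrAC subrr add0r.
  apply: ge0_le_lower_integral => [t _|t] /=.
    by rewrite lee_fin ltW// (le_lt_trans _ wc).
  rewrite in_itv/= => /andP[zt tzh]; apply: r1H.
  rewrite /ball/= distrC gtr0_norm ?subr_gt0// (le_lt_trans _ hr1)//.
  by rewrite lerBlDl.
move: Pz; rewrite /P zE => /le_trans; apply.
rewrite /G (splitr e) EFinD addeA; apply: leeD.
  apply: le_trans Iu; apply: ge0_subset_integral => //.
rewrite lee_fin /eta -mulrA ler_piMr//; first exact: ltW.
by rewrite ler_pdivrMl ?ltr0n// mulr1 ler_nat.
Qed.
End FTC.

(** * Connecting full-rank matrices *)

Section FullRank.
Context {F : fieldType} {n m : nat}.
Implicit Types (a b : 'M[F]_(n, m)) (x : 'cV[F]_m).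

Lemma full_rankP a :
  reflect (forall x, a *m x = 0 -> x = 0) (\rank a == m).
Proof.
rewrite -mxrank_tr -[_ == m]/(row_free a^T) -kermx_eq0.
apply: (iffP eqP) => [k0 x ax0|H].
  have : (x^T <= kermx a^T)%MS.
    by apply/sub_kermxP; rewrite -trmx_mul ax0 trmx0.
  by rewrite k0 submx0 => /eqP/(congr1 trmx); rewrite trmxK trmx0.
apply/row_matrixP => i; rewrite row0.
apply: trmx_inj; rewrite trmx0; apply: H.
by apply: trmx_inj; rewrite trmx_mul trmxK trmx0 -row_mul mulmx_ker row0.
Qed.

End FullRank.

Section Chain.
Context {R : realFieldType} {n m : nat}.
Implicit Types (a b : 'M[R]_(n, m)).

Definition full_rank_segment a b :=
  forall t, 0 <= t <= 1 -> \rank (a + t *: (b - a))%R = m.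

(** If [(a + t w phi) x = 0] with [w] outside the column space of [a], then
[t (phi x) = 0], hence [a x = 0]. *)
Lemma segment_outside a (w : 'cV[R]_n) (phi : 'rV[R]_m) :
  \rank a = m -> ~ (exists y, a *m y = w) -> full_rank_segment a (a + w *m phi).
Proof.
move=> /eqP/full_rankP fa wa t _; apply/eqP/full_rankP => x.
rewrite addrAC subrr add0r mulmxDl -scalemxAl -mulmxA.
rewrite [phi *m x]mx11_scalar mul_mx_scalar scalerA.
set c := t * _; have [->|c0] := eqVneq c 0; first by rewrite scale0r addr0 => /fa.
move=> H; exfalso; apply: wa; exists (- c^-1 *: x).
have aE : a *m x = - (c *: w) by apply/eqP; rewrite -addr_eq0 H.
by rewrite -scalemxAr aE scalerN scaleNr opprK scalerA mulVf// scale1r.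
Qed.

Lemma outside_column_space a : (m < n)%N -> exists w : 'cV[R]_n, ~ exists y, a *m y = w.
Proof.
move=> mn.
have [i Hi] : exists i, ~~ (row i (1%:M : 'M[R]_n) <= a^T)%MS.
  apply/existsP; rewrite -negb_forall; apply/negP => /forallP H.
  have /row_subP/mxrankS : forall i, (row i (1%:M : 'M[R]_n) <= a^T)%MS by [].
  by rewrite mxrank1 leqNgt (leq_ltn_trans _ mn)// rank_leq_row.
exists (row i (1%:M : 'M[R]_n))^T => -[y /(congr1 trmx)]; rewrite trmx_mul trmxK => yE.
by move: Hi; rewrite -yE submxMl.
Qed.

Section Connected.
Variable P : 'M[R]_(n, m) -> 'M[R]_(n, m) -> Prop.
Hypothesis mn : (m < n)%N.
Hypothesis P_trans : forall a b c, P a b -> P b c -> P a c.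
Hypothesis P_segment : forall a b, full_rank_segment a b -> P a b.

(** When [w = a y] lies in the column space, detour through [a + v phi] with [v]
outside it.  The second segment is admissible since [w - v] in the column space
of [a + v phi] would force [phi y = -1], and then [y] would be in the kernel of
[a + w phi]. *)
Lemma connect_rank1 a (w : 'cV[R]_n) (phi : 'rV[R]_m) :
  \rank a = m -> \rank (a + w *m phi)%R = m -> P a (a + w *m phi).
Proof.
move=> ra rb.
have [[y yw]|] := pselect (exists y, a *m y = w); last first.
  by move=> wa; apply: P_segment; exact: segment_outside.
have [v va] := outside_column_space a mn.
have Pav : P a (a + v *m phi) by apply: P_segment; exact: segment_outside.
apply: (P_trans Pav).
have -> : a + w *m phi = (a + v *m phi) + (w - v) *m phi.
  by rewrite mulmxBl -addrA [v *m phi + _]addrC subrK.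
apply: P_segment; apply: segment_outside.
  by have := segment_outside phi ra va (t := 1); rewrite scale1r addrC subrK; apply;
    rewrite ler01 lexx.
move=> [x]; rewrite mulmxDl -mulmxA [phi *m x]mx11_scalar mul_mx_scalar -yw.
set c := (phi *m x) 0 0 => xE.
have c1 : c = - 1.
  apply/eqP; rewrite -addr_eq0; apply/eqP.
  apply: contra_notP va => /eqP c10.
  exists ((c + 1)^-1 *: (y - x)); rewrite -scalemxAr mulmxBr.
  have -> : a *m y - a *m x = (c + 1) *: v.
    rewrite scalerDl scale1r; apply/eqP; rewrite subr_eq addrAC -subr_eq; apply/eqP.
    by rewrite -xE addrC.
  by rewrite scalerA mulVf// scale1r.
have xy : x = y.
  have /full_rankP inj : \rank a == m by rewrite ra.
  move: xE; rewrite c1 scaleN1r => /addIr E.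
  by apply/eqP; rewrite -subr_eq0; apply/eqP/inj; rewrite mulmxBr E subrr.
have y0 : y = 0.
  have /full_rankP inj : \rank (a + w *m phi)%R == m by rewrite rb.
  apply: inj; rewrite mulmxDl -mulmxA [phi *m y]mx11_scalar mul_mx_scalar -xy -/c c1.
  by rewrite xy yw scaleN1r subrr.
move: c1; rewrite /c xy y0 mulmx0 mxE => /eqP; rewrite eq_sym oppr_eq0 oner_eq0//.
Qed.

Lemma form2_neq0 (p q : 'rV[R]_m) : p != 0 -> q != 0 ->
  exists y : 'cV[R]_m, (p *m y) 0 0 != 0 /\ (q *m y) 0 0 != 0.
Proof.
have nz (r : 'rV[R]_m) : r != 0 -> exists y : 'cV[R]_m, (r *m y) 0 0 != 0.
  move=> r0; have [i ri] : exists i, r 0 i != 0.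
    by apply/existsP; apply: contraNT r0 => /existsPn H; apply/eqP/rowP => i;
      rewrite mxE; apply/eqP; rewrite -[_ == _]negbK.
  exists (delta_mx i 0); rewrite -colE mxE//.
move=> /nz[y py] /nz[z qz].
have [qy|qy] := eqVneq ((q *m y) 0 0) 0; last by exists y.
have [pz|pz] := eqVneq ((p *m z) 0 0) 0; last by exists z.
exists (y + z); rewrite !mulmxDr !mxE.
move: py qz qy pz; rewrite !mxE => py qz -> ->.
by rewrite addr0 add0r.
Qed.

(** Induction on the rank of [d = b - a].  Adding to [a] the rank-one matrix
[d y psi d / (psi d y)] lowers that rank (Wedderburn), and [psi], [y] can be
chosen so that full rank is kept: if [d y] is outside the column space of [a]
any [psi] with [psi d y] nonzero works, and if [d = a e] it suffices that
[psi d (1 + e) y] be nonzero too, which is possible because [b = a (1 + e)]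
makes [1 + e] invertible. *)
Lemma connect_full_rank a b : \rank a = m -> \rank b = m -> P a b.
Proof.
have [r] := ubnP (\rank (b - a)%R); elim: r a => // r IH a /ltnSE rba ra rb.
have [d bE] : exists d, b = a + d by exists (b - a); rewrite addrC subrK.
move: rba rb; rewrite bE [a + d - a]addrAC subrr add0r => rba rb.
have [d0|d0] := eqVneq d 0.
  by apply: P_segment => t _; rewrite d0 addr0 subrr scaler0 addr0.
suff [y [psi [nz fa']]] : exists (y : 'cV[R]_m) (psi : 'rV[R]_n),
    (psi *m d *m y) 0 0 != 0 /\
    \rank (a + d *m y *m (((psi *m d *m y) 0 0)^-1 *: (psi *m d)))%R = m.
  apply: (P_trans (connect_rank1 ra fa')).
  rewrite -bE; apply: IH; rewrite ?bE//; apply: leq_trans rba.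
  set q := _ 0 0 in nz fa' *.
  have dE : a + d - (a + d *m y *m (q^-1 *: (psi *m d))) =
      (1%:M - q^-1 *: (d *m y *m psi)) *m d.
    by rewrite mulmxBl mul1mx opprD addrA [a + d - a]addrAC subrr add0r -scalemxAr
      -scalemxAl !mulmxA.
  rewrite dE; apply: rank_ltmx; rewrite /ltmx submxMl/=.
  apply/negP => /submxP[D DE].
  have : d *m y = 0.
    rewrite {1}DE -!mulmxA [X in D *m X](_ : _ = 0) ?mulmx0//.
    rewrite mulmxBl mul1mx -scalemxAl -!mulmxA [psi *m (d *m y)]mx11_scalar.
    by rewrite [psi *m (d *m y)]mulmxA -/q mul_mx_scalar -scalemxAr scalerA mulVf//
      scale1r subrr.
  by move=> dy; move: nz; rewrite /q -mulmxA dy mulmx0 mxE eqxx.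
(* the case d = a e; otherwise some column of d is outside the column space *)
have [[e de]|nde] := pselect (exists e : 'M[R]_m, d = a *m e); last first.
  have [j Hj] : exists j, ~ exists y, a *m y = col j d.
    apply/existsNP => H; apply: nde.
    pose e := \matrix_(i, j) (projT1 (cid (H j))) i 0.
    exists e; apply/matrixP => i j; have := projT2 (cid (H j)) => /colP/(_ i).
    rewrite !mxE => <-; apply: eq_bigr => k _; by rewrite mxE.
  have [i ij] : exists i, d i j != 0.
    apply/existsP; apply: contra_notT Hj => /existsPn H.
    exists 0; rewrite mulmx0; apply/colP => i; rewrite !mxE.
    by apply/esym/eqP; rewrite -[_ == _]negbK.
  exists (delta_mx j 0), (delta_mx 0 i).
  rewrite -rowE -[row i d *m _]colE !mxE; split => //.
  have Hj' : ~ exists y, a *m y = d *m (delta_mx j 0 : 'cV_m) by rewrite -colE.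
  have := segment_outside ((d i j)^-1 *: row i d) ra Hj' (t := 1).
  by rewrite scale1r addrC subrK; apply; rewrite ler01 lexx.
have adE : a + d = a *m (1%:M + e) by rewrite mulmxDr mulmx1 -de.
have ur : d *m (1%:M + e) != 0.
  apply: contraNneq d0 => de0.
  have ue : (1%:M + e) \in unitmx.
    rewrite -unitmx_tr -row_free_unit /row_free mxrank_tr.
    apply/full_rankP => x ex; have /full_rankP : \rank (a + d)%R == m by rewrite rb.
    by apply; rewrite adE -mulmxA ex mulmx0.
  by rewrite -[d](mulmxK ue) de0 mul0mx.
have [i Hi] : exists i, row i (d *m (1%:M + e)) != 0.
  apply/existsP; apply: contraNT ur => /existsPn H; apply/eqP/row_matrixP => i.
  by rewrite row0; apply/eqP; rewrite -[_ == _]negbK.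
have Hi' : row i d != 0 by apply: contraNneq Hi => H; rewrite row_mul H mul0mx.
have [y []] := form2_neq0 Hi' Hi.
rewrite row_mul rowE => nz1 nz2.
exists y, (delta_mx 0 i); split => //.
set psi := delta_mx 0 i in nz1 nz2 *.
set q := _ 0 0 in nz1 *.
apply/eqP/full_rankP => x.
rewrite mulmxDl -!mulmxA [(_ *: _) *m x]mx11_scalar.
set c := (_ *m x) 0 0.
rewrite de -mulmxA mul_mx_scalar -scalemxAr -mulmxDr.
have /full_rankP inj : \rank a == m by rewrite ra.
move=> /inj/eqP; rewrite addr_eq0 => /eqP xE.
have cq : q * c = (psi *m d *m x) 0 0 by rewrite /c -scalemxAl mxE mulrA mulfV// mul1r.
have : c * (psi *m d *m (1%:M + e) *m y) 0 0 == 0.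
  rewrite mulmxDr mulmx1 mulmxDl mxE -/q mulrDr [c * q]mulrC cq xE.
  by rewrite mulmxN -scalemxAr -[psi *m d *m e *m y]mulmxA 2!mxE addNr.
by rewrite mulf_eq0 (negPf nz2) orbF xE => /eqP ->; rewrite scale0r oppr0.
Qed.

End Connected.
End Chain.

(** * Frobenius norm and Gram matrix *)

Section SquaredNorm.
Context {R : realFieldType}.

Lemma sum_Cauchy_Schwarz (I : finType) (x y : I -> R) :
  (\sum_i x i * y i) ^+ 2 <= (\sum_i x i ^+ 2) * (\sum_i y i ^+ 2).
Proof.
set B := \sum_i x i * y i; set A := \sum_i _ ^+ 2; set C := \sum_i y i ^+ 2.
have C0 : 0 <= C by apply: sumr_ge0 => i _; exact: sqr_ge0.
have sqE c b : \sum_i (c * x i - b * y i) ^+ 2 = c ^+ 2 * A - 2 * c * b * B + b ^+ 2 * C.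
  rewrite /A /B /C !mulr_sumr -sumrB -big_split/=.
  by apply: eq_bigr => i _; ring.
have H : 0 <= C * (A * C - B ^+ 2).
  have -> : C * (A * C - B ^+ 2) = \sum_i (C * x i - B * y i) ^+ 2 by rewrite sqE; ring.
  by apply: sumr_ge0 => i _; exact: sqr_ge0.
have [C_eq0|Cn0] := eqVneq C 0.
  have y0 i : y i = 0.
    apply/eqP; rewrite -sqrf_eq0 eq_le sqr_ge0 andbT -[leRHS]C_eq0 /C (bigD1 i)//=.
    by rewrite lerDl sumr_ge0// => j _; exact: sqr_ge0.
  by rewrite C_eq0 mulr0 /B big1 ?expr0n// => i _; rewrite y0 mulr0.
by rewrite -subr_ge0 -(@pmulr_rge0 _ C)// lt_neqAle eq_sym Cn0.
Qed.

Definition sqnorm {p q : nat} (u : 'M[R]_(p, q)) : R := \tr (u *m u^T).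

Lemma mxtrace_mul_tr (p q : nat) (u v : 'M[R]_(p, q)) :
  \tr (u *m v^T) = \sum_(ij : 'I_p * 'I_q) u ij.1 ij.2 * v ij.1 ij.2.
Proof.
rewrite /mxtrace -(pair_big xpredT xpredT (fun i j => u i j * v i j))/=.
by apply: eq_bigr => i _; rewrite mxE; apply: eq_bigr => j _; rewrite mxE.
Qed.

Lemma sqnormE (p q : nat) (u : 'M[R]_(p, q)) :
  sqnorm u = \sum_(ij : 'I_p * 'I_q) u ij.1 ij.2 ^+ 2.
Proof. exact: mxtrace_mul_tr. Qed.

Lemma sqnorm_ge0 (p q : nat) (u : 'M[R]_(p, q)) : 0 <= sqnorm u.
Proof. by rewrite sqnormE sumr_ge0// => ij _; exact: sqr_ge0. Qed.

Lemma sqr_coord_le_sqnorm (p q : nat) (u : 'M[R]_(p, q)) i j : u i j ^+ 2 <= sqnorm u.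
Proof.
rewrite sqnormE (bigD1 (i, j))//= lerDl sumr_ge0// => ij _; exact: sqr_ge0.
Qed.

Lemma sqnorm_eq0 (p q : nat) (u : 'M[R]_(p, q)) : sqnorm u = 0 -> u = 0.
Proof.
move=> u0; apply/matrixP => i j; rewrite mxE; apply/eqP.
by rewrite -sqrf_eq0 eq_le sqr_ge0 andbT -u0 sqr_coord_le_sqnorm.
Qed.

Lemma sqr_mxtrace_mul_le (p q : nat) (u v : 'M[R]_(p, q)) :
  \tr (u *m v^T) ^+ 2 <= sqnorm u * sqnorm v.
Proof. by rewrite mxtrace_mul_tr !sqnormE; exact: sum_Cauchy_Schwarz. Qed.

Lemma sqnorm_mul_le (p q r : nat) (u : 'M[R]_(p, q)) (v : 'M[R]_(q, r)) :
  sqnorm (u *m v) <= sqnorm u * sqnorm v.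
Proof.
rewrite !sqnormE -!(pair_big xpredT xpredT (fun i j => _ i j ^+ 2))/=.
rewrite [X in _ <= _ * X]exchange_big big_distrlr/=.
apply: ler_sum => i _; apply: ler_sum => j _.
by rewrite mxE; exact: sum_Cauchy_Schwarz.
Qed.

End SquaredNorm.

Section Gram.
Context {R : rcfType} {n m : nat}.
Implicit Types (a u : 'M[R]_(n, m)).

Definition gram a : 'M[R]_m := a^T *m a.

Lemma gramT a : (gram a)^T = gram a.
Proof. by rewrite /gram trmx_mul trmxK. Qed.

Lemma sqnorm_trE (x : 'cV[R]_m) a : sqnorm ((a *m x)^T) = (x^T *m gram a *m x) 0 0.
Proof. by rewrite /sqnorm trmxK trmx_mul /gram trace_mx11 !mulmxA. Qed.

(** [x^T ((1 - t) + t g) x = (1 - t) |x|^2 + t |a x|^2]. *)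
Lemma definite_pencil_unit a t : \rank a = m -> 0 <= t <= 1 ->
  (1 - t)%:M + t *: gram a \in unitmx.
Proof.
move=> /eqP/full_rankP fa /andP[t0 t1].
rewrite -unitmx_tr -row_free_unit /row_free mxrank_tr; apply/full_rankP => x.
move=> /(congr1 (mulmx x^T)); rewrite mulmx0 mulmxDl mulmxDr mul_scalar_mx.
rewrite -scalemxAl -!scalemxAr => /matrixP/(_ 0 0).
rewrite mulmxA [LHS]mxE [X in X + _]mxE [X in _ + X]mxE -sqnorm_trE.
have -> : (x^T *m x) 0 0 = sqnorm x^T by rewrite /sqnorm trmxK trace_mx11.
rewrite mxE => /eqP; rewrite paddr_eq0 ?mulr_ge0 ?sqnorm_ge0 ?subr_ge0//.
move=> /andP[]; rewrite !mulf_eq0 subr_eq0 => /orP[/eqP <-|/eqP/sqnorm_eq0].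
  rewrite oner_eq0/= => /eqP/sqnorm_eq0/(congr1 trmx).
  by rewrite trmxK trmx0 => /fa.
by move=> /(congr1 trmx); rewrite trmxK trmx0.
Qed.

Lemma gram_unit a : \rank a = m -> gram a \in unitmx.
Proof.
move=> ra; have := definite_pencil_unit ra (t := 1).
by rewrite subrr scale1r raddf0 add0r; apply; rewrite ler01 lexx.
Qed.

(** The determinant of [(1 - t) + t g] is 1 at [t = 0] and does not vanish on
[[0, 1]]. *)
Lemma det_gram_gt0 a : \rank a = m -> 0 < \det (gram a).
Proof.
move=> ra.
pose A : 'M[{poly R}]_m := (1 - 'X)%:M + 'X *: map_mx polyC (gram a).
have AE t : (\det A).[t] = \det ((1 - t)%:M + t *: gram a).
  rewrite -horner_evalE -det_map_mx; congr (\det _).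
  by apply/matrixP => i j; rewrite !mxE /= /horner_eval hornerD hornerM hornerMn !hornerE.
have A0 : (\det A).[0] = 1 by rewrite AE subr0 scale0r addr0 det1.
have A1 : (\det A).[1] = \det (gram a).
  by rewrite AE subrr scale1r raddf0 add0r.
rewrite -A1 ltNge; apply/negP => le0.
have [t t01] : exists2 t, 0 <= t <= 1 & root (- \det A) t.
  by apply: poly_ivt => //; rewrite !hornerN A0 oppr_ge0 le0 oppr_le0 ler01.
rewrite rootN /root AE => /eqP d0.
by have := definite_pencil_unit ra t01; rewrite unitmxE d0 unitr0.
Qed.

Lemma det_gram_eq0 a : (\rank a < m)%N -> \det (gram a) = 0.
Proof.
move=> ra; apply/eqP; apply: contraTT ra; rewrite -unitfE -unitmxE -leqNgt => ug.
by have := mxrankM_maxr a^T a; rewrite -/(gram a) mxrank_unit.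
Qed.

(** The [p] of the introduction: the solution of [p a = u] that annihilates the
orthogonal complement of the column space of [a]. *)
Definition lifted_velocity a u : 'M[R]_n := u *m invmx (gram a) *m a^T.

Lemma lifted_velocityK a u : \rank a = m -> lifted_velocity a u *m a = u.
Proof. by move=> /gram_unit ug; rewrite /lifted_velocity -mulmxA -/(gram a) mulmxKV. Qed.

Lemma sqnorm_lifted a u : \rank a = m ->
  sqnorm (lifted_velocity a u) = \tr (u *m invmx (gram a) *m u^T).
Proof.
move=> /gram_unit ug; rewrite /sqnorm /lifted_velocity.
rewrite !trmx_mul trmxK trmx_inv gramT !mulmxA.
by rewrite -[u *m _ *m _ *m a]mulmxA -/(gram a) mulmxKV// -mulmxA.
Qed.

(** [p = p pi] for the orthogonal projection [pi] onto the column space of [a],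
and [|pi|^2 = m]; apply Cauchy-Schwarz to [tr (p pi)]. *)
Lemma sqr_trace_lifted_le a u : \rank a = m ->
  \tr (lifted_velocity a u) ^+ 2 <= m%:R * sqnorm (lifted_velocity a u).
Proof.
move=> ra; have ug := gram_unit ra.
(* a g^-1 a^T, the orthogonal projection onto the column space *)
pose pi := lifted_velocity a a.
have piT : pi^T = pi.
  by rewrite /pi /lifted_velocity !trmx_mul trmxK trmx_inv gramT mulmxA.
have -> : \tr (lifted_velocity a u) = \tr (lifted_velocity a u *m pi^T).
  by rewrite piT /pi [lifted_velocity a a]/lifted_velocity !mulmxA lifted_velocityK.
apply: le_trans (sqr_mxtrace_mul_le _ _) _; rewrite mulrC.
by rewrite /pi (sqnorm_lifted a ra) mxtrace_mulC mulmxA -/(gram a) mulmxV// mxtrace1.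
Qed.

Lemma sqnorm_le_lifted a u : \rank a = m ->
  sqnorm u <= sqnorm (lifted_velocity a u) * sqnorm a.
Proof. by move=> ra; rewrite -{1}(lifted_velocityK u ra); exact: sqnorm_mul_le. Qed.

End Gram.

(** * Derivatives along curves *)

Section DetDerive.
Context {R : realType}.
Implicit Types (t : R).

Lemma is_derive_bigsum (I : Type) (r : seq I) (f : I -> R -> R) (f' : I -> R) t :
  (forall i, is_derive t 1 (f i) (f' i)) ->
  is_derive t 1 (fun s => \sum_(i <- r) f i s) (\sum_(i <- r) f' i).
Proof.
move=> df; elim: r => [|i r IH].
  by rewrite big_nil; under eq_fun do rewrite big_nil; exact: is_derive_cst.
by rewrite big_cons; under eq_fun do rewrite big_cons; exact: is_deriveD.
Qed.

Lemma is_derive_mul (f g : R -> R) (a b : R) t :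
  is_derive t 1 f a -> is_derive t 1 g b ->
  is_derive t 1 (fun s => f s * g s) (a * g t + f t * b).
Proof.
by move=> df dg; apply: (is_derive_eq (is_deriveM df dg));
  rewrite /GRing.scale/= addrC [g t * a]mulrC.
Qed.

Lemma is_derive_bigprod (I : eqType) (r : seq I) (f : I -> R -> R) (f' : I -> R) t :
  uniq r -> (forall i, is_derive t 1 (f i) (f' i)) ->
  is_derive t 1 (fun s => \prod_(i <- r) f i s)
    (\sum_(k <- r) f' k * \prod_(i <- r | i != k) f i t).
Proof.
move=> + df; elim: r => [_|a r IH /= /andP[ar ur]].
  by rewrite big_nil; under eq_fun do rewrite big_nil; exact: is_derive_cst.
under eq_fun do rewrite big_cons.
apply: (is_derive_eq (is_derive_mul (df a) (IH ur))).
rewrite big_cons; congr (_ + _).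
  congr (_ * _); rewrite big_cons eqxx/= big_seq_cond [in RHS]big_seq_cond.
  by apply: eq_bigl => i; case: eqVneq => [->|]; rewrite ?(negPf ar)// andbT.
rewrite mulr_sumr; apply: eq_big_seq => k kr.
rewrite big_cons; case: eqVneq => [ak|_]; first by rewrite ak kr in ar.
by rewrite mulrCA.
Qed.

(** Jacobi's formula.  Differentiating the Leibniz expansion replaces one row at
a time by its derivative; expand each such determinant along that row. *)
Lemma is_derive_det (k : nat) (A : R -> 'M[R]_k) (A' : 'M[R]_k) t :
  (forall i j, is_derive t 1 (fun s => A s i j) (A' i j)) ->
  is_derive t 1 (fun s => \det (A s)) (\tr (\adj (A t) *m A')).
Proof.
move=> dA; rewrite /determinant.
pose M l : 'M[R]_k := \matrix_(i, j) if i == l then A' i j else A t i j.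
have -> : \tr (\adj (A t) *m A') = \sum_l \det (M l).
  rewrite mxtrace_mulC /mxtrace; apply: eq_bigr => l _.
  rewrite (expand_det_row _ l) !mxE; apply: eq_bigr => j _.
  rewrite !mxE eqxx; congr (_ * _); rewrite /cofactor; congr (_ * \det _).
  by apply/matrixP => i j'; rewrite !mxE eq_sym (negPf (neq_lift _ _)).
apply: (is_derive_eq (f' := \sum_(s : 'S_k) (-1) ^+ s *
   \sum_l A' l (s l) * \prod_(i | i != l) A t i (s i))).
  apply: is_derive_bigsum => s.
  have := is_derive_bigprod (index_enum_uniq _) (fun i => dA i (s i)).
  move=> /(is_derive_mul (is_derive_cst ((-1) ^+ s : R) t 1)) H.
  by apply: (is_derive_eq H); rewrite mul0r add0r.
rewrite [RHS](eq_bigr (fun l => \sum_(s : 'S_k)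
    (-1) ^+ s * (A' l (s l) * \prod_(i | i != l) A t i (s i)))).
  by rewrite exchange_big; apply: eq_bigr => s _; rewrite mulr_sumr.
move=> l _; apply: eq_bigr => s _; congr (_ * _); rewrite (bigD1 l)//= !mxE eqxx.
by congr (_ * _); apply: eq_bigr => i il; rewrite mxE (negPf il).
Qed.

End DetDerive.

Section CurveDerive.
Context {R : realType} {n m : nat}.
Implicit Types (c : R -> 'M[R]_(n, m)) (a u : 'M[R]_(n, m)) (t : R).

Lemma is_derive_coord c t i j : derivable c t 1 ->
  is_derive t 1 (fun s => c s i j) (derive1 c t i j).
Proof.
move=> dc; apply: DeriveDef; first by move/derivable_mxP : dc; exact.
by rewrite derive1E derive_mx// mxE.
Qed.

Lemma is_derive_sqnorm c t : derivable c t 1 ->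
  is_derive t 1 (fun s => sqnorm (c s)) (2 * \tr (derive1 c t *m (c t)^T)).
Proof.
move=> dc; under eq_fun do rewrite sqnormE.
have H := is_derive_bigsum (index_enum ('I_n * 'I_m)%type)
  (fun ij => is_derive_mul (is_derive_coord ij.1 ij.2 dc) (is_derive_coord ij.1 ij.2 dc)).
apply: (is_derive_eq H); rewrite mxtrace_mul_tr mulr_sumr.
by apply: eq_bigr => ij _; ring.
Qed.

Lemma is_derive_det_gram c t : derivable c t 1 -> \rank (c t) = m ->
  is_derive t 1 (fun s => \det (gram (c s)))
    (2 * \det (gram (c t)) * \tr (lifted_velocity (c t) (derive1 c t))).
Proof.
move=> dc rc; set u := derive1 c t; set a := c t.
have H : forall i j, is_derive t 1 (fun s => gram (c s) i j) ((u^T *m a + a^T *m u) i j).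
  move=> i j; under eq_fun do rewrite mxE.
  have H := is_derive_bigsum (index_enum 'I_n)
    (fun k => is_derive_mul (is_derive_coord k i dc) (is_derive_coord k j dc)).
  under eq_fun do under eq_bigr do rewrite mxE.
  apply: (is_derive_eq H); rewrite !mxE -big_split/=.
  by apply: eq_bigr => k _; rewrite !mxE.
apply: (is_derive_eq (is_derive_det H)).
have ug := gram_unit rc; have d0 : \det (gram a) != 0 by rewrite gt_eqF// det_gram_gt0.
have -> : \adj (gram a) = \det (gram a) *: invmx (gram a).
  by rewrite /invmx ug scalerA mulfV// scale1r.
rewrite -scalemxAl mxtraceZ mulmxDr raddfD/=.
have E : \tr (invmx (gram a) *m (a^T *m u)) = \tr (lifted_velocity a u).
  by rewrite mxtrace_mulC -mulmxA mxtrace_mulC.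
have -> : \tr (invmx (gram a) *m (u^T *m a)) = \tr (lifted_velocity a u).
  by rewrite -E -mxtrace_tr !trmx_mul trmxK trmx_inv gramT mxtrace_mulC.
by rewrite E; ring.
Qed.

(** The conformal factor of the speed: the velocity [p a] has speed [|p|] times
this. *)
Definition quartic_volume a := Num.sqrt (Num.sqrt (\det (gram a))).

Lemma quartic_volume_ge0 a : 0 <= quartic_volume a.
Proof. exact: sqrtr_ge0. Qed.

Lemma quartic_volume_gt0 a : \rank a = m -> 0 < quartic_volume a.
Proof. by move=> ra; rewrite !sqrtr_gt0 det_gram_gt0. Qed.

Lemma quartic_volume_eq0 a : (\rank a < m)%N -> quartic_volume a = 0.
Proof. by move=> ra; rewrite /quartic_volume det_gram_eq0// !sqrtr0. Qed.

Lemma speedE a u : \rank a = m ->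
  Num.sqrt (riem_metric a u u) = Num.sqrt (sqnorm (lifted_velocity a u)) * quartic_volume a.
Proof.
by move=> ra; rewrite /riem_metric -/(gram a) -sqnorm_lifted// sqrtrM ?sqnorm_ge0.
Qed.

(** The distance from [a] to the collapsed point, the [rho] of the introduction. *)
Definition collapse_radius a : R := 2 / Num.sqrt m%:R * quartic_volume a.

(** With [q] the quartic volume and [T = tr p], the derivative is
[q * T / sqrt m]. *)
Lemma is_derive_collapse_radius c t : derivable c t 1 -> \rank (c t) = m ->
  exists d, is_derive t 1 (collapse_radius \o c) d /\
    `|d| <= Num.sqrt (riem_metric (c t) (derive1 c t) (derive1 c t)).
Proof.
move=> dc rc; have D0 := det_gram_gt0 rc; have dD := is_derive_det_gram dc rc.
set T := \tr _ in dD.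
set D := \det (gram (c t)) in D0 dD.
have s0 : 0 < Num.sqrt D by rewrite sqrtr_gt0.
have ds1 := @is_derive1_comp _ Num.sqrt (fun s => \det (gram (c s))) t _ _
  (is_derive1_sqrt D0) dD.
have ds2 := @is_derive1_comp _ Num.sqrt (fun s => Num.sqrt (\det (gram (c s)))) t _ _
  (is_derive1_sqrt s0) ds1.
have ds3 := is_derive_mul (is_derive_cst (2 / Num.sqrt m%:R : R) t 1) ds2.
set d := _ + _ in ds3; exists d; split; first exact: ds3.
rewrite speedE//; set p := lifted_velocity _ _.
set q := quartic_volume _.
have q0 : 0 < q by exact: quartic_volume_gt0.
have qs : Num.sqrt D = q ^+ 2 by rewrite sqr_sqrtr// sqrtr_ge0.
have qD : D = q ^+ 4 by rewrite -[LHS]sqr_sqrtr ?ltW// qs -exprM.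
(* det g = q ^+ 4, so d (sqrt (sqrt D)) = (2 q)^-1 (2 q^2)^-1 (2 q^4 T) *)
have -> : d = (Num.sqrt m%:R)^-1 * T * q.
  rewrite /d mul0r add0r /cst.
  rewrite qs sqrtr_sqr (gtr0_norm q0) qD; move: (_^-1) => r.
  by field; rewrite gt_eqF.
rewrite normrM (gtr0_norm q0) ler_pM2r//.
have T2 : `|T| <= Num.sqrt m%:R * Num.sqrt (sqnorm p).
  rewrite -sqrtrM ?ler0n// -sqrtr_sqr ler_wsqrtr//.
  exact: sqr_trace_lifted_le.
rewrite normrM ger0_norm ?invr_ge0 ?sqrtr_ge0//.
apply: (le_trans (ler_wpM2l _ T2)); first by rewrite invr_ge0 sqrtr_ge0.
rewrite mulrA ler_piMl ?sqrtr_ge0//.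
by have [->|m0] := eqVneq (Num.sqrt m%:R) (0 : R); rewrite ?mulr0// mulVf.
Qed.

(** From [u = p a]: [|u| <= |p| |a|], and the speed is [|p| q]. *)
Lemma velocity_le a u (q0 : R) : \rank a = m -> 0 <= q0 <= quartic_volume a ->
  q0 * Num.sqrt (sqnorm u) <= Num.sqrt (riem_metric a u u) * Num.sqrt (sqnorm a).
Proof.
move=> ra /andP[q00 q0q]; rewrite speedE// mulrAC mulrC.
apply: ler_pM => //; rewrite ?sqrtr_ge0//.
by rewrite -sqrtrM ?sqnorm_ge0// ler_wsqrtr// sqnorm_le_lifted.
Qed.

(** Keeps a curve bounded while its volume is bounded below.  [1 + |c|^2] is used
rather than [|c|^2] so that the logarithm is defined everywhere. *)
Lemma is_derive_ln_sqnorm c t (q0 : R) : derivable c t 1 -> \rank (c t) = m ->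
  0 <= q0 <= quartic_volume (c t) ->
  exists d, is_derive t 1 (fun s => q0 / 2 * ln (1 + sqnorm (c s))) d /\
    `|d| <= Num.sqrt (riem_metric (c t) (derive1 c t) (derive1 c t)).
Proof.
move=> dc rc q0q; have N0 := sqnorm_ge0 (c t).
have N1 : 0 < 1 + sqnorm (c t) by rewrite ltr_pwDl.
have d1 := is_deriveD (is_derive_cst (1 : R) t 1) (is_derive_sqnorm dc).
have d2 := @is_derive1_comp _ (@ln R) (fun s => 1 + sqnorm (c s)) t _ _
  (is_derive1_ln N1) d1.
have d3 := is_derive_mul (is_derive_cst (q0 / 2 : R) t 1) d2.
set d := _ + _ in d3; exists d; split; first exact: d3.
have -> : d = q0 * \tr (derive1 c t *m (c t)^T) / (1 + sqnorm (c t)).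
  by rewrite /d mul0r !add0r /cst; field; rewrite gt_eqF.
move: {d d3 d2 d1} (derive1 c t) (c t) rc q0q N0 N1 => u a rc q0q N0 N1.
have q00 : 0 <= q0 by case/andP: q0q.
rewrite normrM normfV (gtr0_norm N1) ler_pdivrMr// normrM (ger0_norm q00).
have : `|\tr (u *m a^T)| <= Num.sqrt (sqnorm u) * Num.sqrt (sqnorm a).
  by rewrite -sqrtrM ?sqnorm_ge0// -sqrtr_sqr ler_wsqrtr// sqr_mxtrace_mul_le.
move=> /(ler_wpM2l q00)/le_trans; apply.
rewrite mulrA; apply: (le_trans (ler_wpM2r (sqrtr_ge0 _) (velocity_le u rc q0q))).
rewrite -mulrA ler_wpM2l ?sqrtr_ge0// -expr2 sqr_sqrtr// lerDr//.
Qed.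

Lemma is_derive_coord_le c t (q0 B : R) i j : derivable c t 1 -> \rank (c t) = m ->
  0 <= q0 <= quartic_volume (c t) -> 0 < B -> sqnorm (c t) <= B ^+ 2 ->
  exists d, is_derive t 1 (fun s => q0 / B * c s i j) d /\
    `|d| <= Num.sqrt (riem_metric (c t) (derive1 c t) (derive1 c t)).
Proof.
move=> dc rc q0q B0 cB.
have d1 := is_derive_mul (is_derive_cst (q0 / B : R) t 1) (is_derive_coord i j dc).
set d := _ + _ in d1; exists d; split; first exact: d1.
have q00 : 0 <= q0 by case/andP: q0q.
rewrite /d {d d1} mul0r add0r /cst; move: (derive1 c t) => u;
  have qB : 0 <= q0 / B by rewrite divr_ge0// ltW.
rewrite normrM (ger0_norm qB) mulrAC ler_pdivrMr//.
have : `|u i j| <= Num.sqrt (sqnorm u).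
  by rewrite -sqrtr_sqr ler_wsqrtr// sqr_coord_le_sqnorm.
move=> /(ler_wpM2l q00)/le_trans; apply.
apply: (le_trans (velocity_le u rc q0q)); rewrite ler_wpM2l ?sqrtr_ge0//.
by rewrite -(ger0_norm (ltW B0)) -sqrtr_sqr ler_wsqrtr.
Qed.

End CurveDerive.

(** * Piecewise differentiable curves *)

Section Pieces.
Context {R : realType} {V : normedModType R}.
Implicit Types (c b : R -> V) (x y z : R).

(** An inductive form of piecewise differentiability, for which concatenation is
a constructor and the other closure properties are inductions; see
[piecewise_differentiableP]. *)
Inductive smooth_pieces c : R -> R -> Prop :=
| one_piece x y b of x < y & {in `[x, y], c =1 b} &
    {in `[x, y], forall t, derivable b t 1} : smooth_pieces c x y
| join_pieces x z y of smooth_pieces c x z & smooth_pieces c z y :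
    smooth_pieces c x y.

Lemma smooth_pieces_lt c x y : smooth_pieces c x y -> x < y.
Proof. by elim => // {}x z {}y _ xz _ zy; exact: lt_trans xz zy. Qed.

Lemma smooth_pieces_continuous c x y : smooth_pieces c x y ->
  {within `[x, y], continuous c}.
Proof.
elim => [{}x {}y b xy cb db|{}x z {}y sxz cxz szy czy].
  have /subspace_eq_continuous : {in `[x, y]%classic, b =1 c}.
    by move=> t; rewrite inE/= => /cb.
  by apply; exact: derivable_within_continuous.
have -> : `[x, y]%classic = `[x, z]%classic `|` `[z, y]%classic.
  have xz := smooth_pieces_lt sxz; have zy := smooth_pieces_lt szy.
  apply/seteqP; split=> t /=; rewrite !in_itv/=.
    by move=> /andP[-> ->]; rewrite andbT; have [|/ltW] := leP t z; [left|right].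
  by move=> [/andP[-> /le_trans->]|/andP[/(le_trans (ltW xz))-> ->]]//; exact: ltW.
by apply: withinU_continuous => //; exact: itv_closed.
Qed.

Lemma smooth_pieces_derivable c x y : smooth_pieces c x y ->
  exists S : seq R, {in `]x, y[, forall t, t \notin S -> derivable c t 1}.
Proof.
elim => [{}x {}y b xy cb db|{}x z {}y sxz [S1 H1] szy [S2 H2]].
  exists [::] => t txy _; have txy' : t \in `[x, y] by exact: subset_itv_oo_cc.
  apply: (@near_eq_derivable _ _ _ b); last exact: db.
  have : nbhs t `]x, y[%classic by apply: open_nbhs_nbhs; split => //; exact: itv_open.
  by apply: filterS => s sxy; apply/esym/cb; exact: subset_itv_oo_cc sxy.
exists (z :: S1 ++ S2) => t; rewrite in_itv/= => /andP[xt ty].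
rewrite inE mem_cat !negb_or => /and3P[tz tS1 tS2].
have [zt|zt] := ltP z t; first by apply: H2; rewrite ?in_itv/= ?zt.
by apply: H1 => //; rewrite in_itv/= xt lt_neqAle tz.
Qed.

(** A negative [al] reverses the order of the end points. *)
Lemma smooth_pieces_affine c c' (al be : R) x y : al != 0 -> smooth_pieces c x y ->
  (forall t, al * t + be \in `[x, y] -> c' t = c (al * t + be)) ->
  if 0 < al then smooth_pieces c' ((x - be) / al) ((y - be) / al)
  else smooth_pieces c' ((y - be) / al) ((x - be) / al).
Proof.
move=> al0; elim=> {x y} [x y b xy cb db|x z y sxz IH1 szy IH2] cc'; last first.
  have xz := smooth_pieces_lt sxz; have zy := smooth_pieces_lt szy.
  have sub1 t : t \in `[x, z] -> t \in `[x, y].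
    by rewrite !in_itv/= => /andP[-> /le_trans->//]; exact: ltW.
  have sub2 t : t \in `[z, y] -> t \in `[x, y].
    by rewrite !in_itv/= => /andP[/(le_trans (ltW xz))-> ->].
  move: (IH1 (fun t H => cc' t (sub1 _ H))) (IH2 (fun t H => cc' t (sub2 _ H))).
  by case: ifP => _ H1 H2; [exact: join_pieces H1 H2|exact: join_pieces H2 H1].
have dphi t : differentiable (fun t => al * t + be : R) t.
  by apply/derivable1_diffP; apply: derivableD => //; apply: derivableM.
have piece p q : p < q ->
    (forall t, t \in `[p, q] -> al * t + be \in `[x, y]) -> smooth_pieces c' p q.
  move=> pq H; apply: (@one_piece _ _ _ (fun t => b (al * t + be))) => // t /H tt.
    by rewrite cc'// cb.
  by apply/derivable1_diffP; apply: differentiable_comp => //; apply/derivable1_diffP/db.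
have [al_gt0|al_le0] := ltP 0 al.
  apply: piece => [|t]; first by rewrite ltr_pM2r ?invr_gt0// ltrD2r.
  by rewrite !in_itv/= ler_pdivrMr// ler_pdivlMr// lerBlDr lerBrDr mulrC.
have al_lt0 : al < 0 by rewrite lt_neqAle al0.
apply: piece => [|t]; first by rewrite ltr_nM2r ?invr_lt0// ltrD2r.
by rewrite !in_itv/= ler_ndivrMr// ler_ndivlMr// lerBlDr lerBrDr mulrC andbC.
Qed.

End Pieces.

Section Partition.
Context {R : realType} {n m : nat}.
Implicit Types (c : R -> 'M[R]_(n, m)).

Lemma smooth_pieces_partition c x y : smooth_pieces c x y ->
  exists2 s : seq R, itv_partition x y s &
    forall i, (i < size s)%N ->
      let I := `[nth 0 (x :: s) i, nth 0 s i] in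
      exists2 b : R -> 'M[R]_(n, m),
        {in I, c =1 b} & {in I, forall t, derivable b t 1}.
Proof.
elim=> {x y} [x y b xy cb db|x z y _ [s1 p1 H1] _ [s2 p2 H2]].
  by exists [:: y]; [exact: itv_partition1|case=> // _; exists b].
exists (s1 ++ s2); first exact: itv_partition_cat p1 p2.
move=> i; rewrite size_cat => isz I.
have [i1|i1] := ltnP i (size s1).
  have -> : I = `[nth 0 (x :: s1) i, nth 0 s1 i].
    by rewrite /I -cat_cons !nth_cat /= i1 ltnW.
  exact: H1.
have -> : I = `[nth 0 (z :: s2) (i - size s1)%N, nth 0 s2 (i - size s1)%N].
  rewrite /I nth_cat ltnNge i1/=; congr `[_, _].
  rewrite -cat_cons nth_cat /= ltnS leq_eqVlt ltnNge i1 orbF.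
  case: eqVneq => [->|ni]; first rewrite subnn /=.
    by case: p1 => _ /eqP <-; rewrite (last_nth 0).
  have i1' : (size s1 < i)%N by rewrite ltn_neqAle eq_sym ni.
  by rewrite -(subnSK i1').
by apply: H2; rewrite ltn_subLR.
Qed.

Lemma partition_smooth_pieces c x y s : itv_partition x y s -> s != [::] ->
  (forall i, (i < size s)%N ->
      let I := `[nth 0 (x :: s) i, nth 0 s i] in
      exists2 b : R -> 'M[R]_(n, m),
        {in I, c =1 b} & {in I, forall t, derivable b t 1}) ->
  smooth_pieces c x y.
Proof.
elim: s x => // z s IH x p _ H.
have [b cb db] := H 0%N isT.
have xz : smooth_pieces c x z.
  by apply: (one_piece _ cb db); case: p => /= /andP[].
have p' := itv_partition_cons p.
have [s0|s0] := eqVneq s [::].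
  by move: p'; rewrite s0 => /itv_partition_nil <-.
apply: (join_pieces xz); apply: IH => // i si.
by have := H i.+1 si.
Qed.

Lemma piecewise_differentiableP c : piecewise_differentiable c <-> smooth_pieces c 0 1.
Proof.
split=> [[s p H]|]; last exact: smooth_pieces_partition.
have s0 : s != [::].
  by apply/eqP => s0; move: p; rewrite s0 => /itv_partition_nil/eqP;
    rewrite eq_sym oner_eq0.
exact: partition_smooth_pieces p s0 H.
Qed.

End Partition.

(** * Functions along curves *)

Section Continuity.
Context {R : realType}.

Lemma continuous_bigsum (T : topologicalType) (I : Type) (r : seq I) (f : I -> T -> R) :
  (forall i, continuous (f i)) -> continuous (fun x => \sum_(i <- r) f i x).
Proof.
move=> cf; elim: r => [|i r IH].
  by under eq_fun do rewrite big_nil; exact: cst_continuous.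
under eq_fun do rewrite big_cons.
by move=> x; apply: continuousD; [exact: cf|exact: IH].
Qed.

Lemma continuous_bigprod (T : topologicalType) (I : Type) (r : seq I) (f : I -> T -> R) :
  (forall i, continuous (f i)) -> continuous (fun x => \prod_(i <- r) f i x).
Proof.
move=> cf; elim: r => [|i r IH].
  by under eq_fun do rewrite big_nil; exact: cst_continuous.
under eq_fun do rewrite big_cons.
by move=> x; apply: continuousM; [exact: cf|exact: IH].
Qed.

Lemma continuous_scale (T : topologicalType) (k : R) (f : T -> R) :
  continuous f -> continuous (fun x => k * f x).
Proof. by move=> cf x; apply: cvgM; [exact: cvg_cst|exact: cf]. Qed.

Lemma continuous_det (T : topologicalType) (k : nat) (A : T -> 'M[R]_k) :
  (forall i j, continuous (fun x => A x i j)) -> continuous (fun x => \det (A x)).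
Proof.
move=> cA; apply: continuous_bigsum => s; apply: continuous_scale.
by apply: (continuous_bigprod (f := fun i x => A x i (s i))) => i; exact: cA.
Qed.

Lemma continuous_adj (T : topologicalType) (k : nat) (A : T -> 'M[R]_k) :
  (forall i j, continuous (fun x => A x i j)) ->
  forall i j, continuous (fun x => \adj (A x) i j).
Proof.
move=> cA i j; under eq_fun do rewrite mxE.
apply: continuous_scale; apply: continuous_det => i' j'; under eq_fun do rewrite !mxE.
exact: cA.
Qed.

Context {n m : nat}.
Implicit Types a : 'M[R]_(n, m).

Lemma continuous_gram i j : continuous (fun a => gram a i j).
Proof.
under eq_fun do rewrite mxE; apply: continuous_bigsum => k a.
under eq_fun do rewrite mxE.
by apply: continuousM; exact: coord_continuous.
Qed.

Lemma continuous_det_gram : continuous (fun a => \det (gram a)).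
Proof. by apply: continuous_det => i j; exact: continuous_gram. Qed.

Lemma continuous_collapse_radius : continuous (@collapse_radius R n m).
Proof.
apply: (continuous_scale (f := @quartic_volume R n m)) => a.
apply: continuous_comp; last exact: sqrt_continuous.
apply: continuous_comp; last exact: sqrt_continuous.
exact: continuous_det_gram.
Qed.

Lemma continuous_sqnorm : continuous (fun a => sqnorm a).
Proof.
under eq_fun do rewrite sqnormE; apply: continuous_bigsum => ij a.
by apply: continuousM; exact: coord_continuous.
Qed.

End Continuity.

Section CurveIncrement.
Context {R : realType} {n m : nat}.
Implicit Types (c : R -> 'M[R]_(n, m)) (a b : 'M[R]_(n, m)).

Definition speed c t := Num.sqrt (riem_metric (c t) (derive1 c t) (derive1 c t)).

(** The bridge from derivatives to distances: a function of the matrix whose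
derivative along curves is at most the speed is 1-Lipschitz for the length. *)
Lemma curve_increment_le c a b (Phi : 'M[R]_(n, m) -> R) :
  admissible_curve a b c ->
  {in `[0, 1], forall t, {for c t, continuous Phi}} ->
  {in `]0, 1[, forall t, derivable c t 1 ->
    exists d, is_derive t 1 (Phi \o c) d /\ `|d| <= speed c t} ->
  {in `[0, 1], forall t, (`|Phi (c t) - Phi a|%:E <= curve_length c)%E}.
Proof.
move=> [/piecewise_differentiableP pc rc c0 _] cPhi dPhi t;
  rewrite in_itv/= => /andP[t0 t1].
have cc := smooth_pieces_continuous pc.
have [S dS] := smooth_pieces_derivable pc.
have sub s : s \in `[0, t] -> s \in `[0, 1].
  by rewrite !in_itv/= => /andP[-> /le_trans->].
have subo s : s \in `]0, t[ -> s \in `]0, 1[.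
  by rewrite !in_itv/= => /andP[-> /lt_le_trans->].
(* the increment lemma is one-sided; apply it to Phi and to - Phi *)
suff main (eps : R) : `|eps| = 1 ->
    ((eps * (Phi (c t) - Phi a))%:E <= curve_length c)%E.
  have := main 1 (normr1 _); have := main (-1) (normrN1 _).
  by rewrite mul1r mulN1r; case: ger0P.
move=> eps1; pose f s := eps * Phi (c s).
have df s : s \in `]0, t[ -> s \notin S ->
    exists d, is_derive s 1 f (eps * d) /\ `|d| <= speed c s.
  move=> s0t sS; have s01 := subo _ s0t.
  have [d [Hd dle]] := dPhi _ s01 (dS _ s01 sS); exists d; split=> //.
  have := is_derive_mul (is_derive_cst (eps : R) s 1) Hd.
  by move=> H; apply: (is_derive_eq H); rewrite mul0r add0r.
have -> : eps * (Phi (c t) - Phi a) = f t - f 0 by rewrite /f c0 mulrBr.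
apply: (le_trans (@increment_le_integral R f 0 t S t0 _ _)).
- apply/subspace_continuousP => s /= s0t.
  have /subspace_continuousP/(_ s (sub _ s0t)) ccs := cc.
  apply: cvgM; first exact: cvg_cst.
  have H : c u @[u --> within `[0, t] (nbhs s)] --> c s.
    apply: cvg_trans ccs; apply: cvg_fmap2; apply: within_subset.
    by move=> u; exact: sub.
  apply: (cvg_comp _ _ H); exact: (cPhi _ (sub _ s0t)).
- by move=> s s0t sS; have [d [[]]] := df s s0t sS.
apply: le_lower_integral => [s _|s _|s]; rewrite ?lee_fin//.
rewrite !patchE; case: ifPn => [|_]; last by case: ifPn => // _; rewrite lee_fin sqrtr_ge0.
rewrite inE => -[/= s0t /negP sS].
rewrite mem_set/=; last by apply/sub/subset_itv_oo_cc.
have [d [[fs fd] dle]] := df s s0t sS.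
by rewrite lee_fin derive1E fd normrM eps1 mul1r.
Qed.

End CurveIncrement.

(** * Operations on curves and special curves *)

Section CurveOperations.
Context {R : realType} {n m : nat}.
Implicit Types (c : R -> 'M[R]_(n, m)) (a b e : 'M[R]_(n, m)).

Lemma derive1_affine c c' (al be t : R) : derivable c (al * t + be) 1 ->
  (\forall s \near t, c' s = c (al * s + be)) ->
  derive1 c' t = al *: derive1 c (al * t + be).
Proof.
move=> dc cc'; rewrite derive1E (near_eq_derive _ cc').
have dphi : is_derive t 1 (fun s => al * s + be) al.
  have := is_deriveD (is_derive_mul (is_derive_cst al t 1) (is_derive_id t 1))
    (is_derive_cst be t 1).
  by move=> H; apply: (is_derive_eq H); rewrite mul0r add0r /cst mulr1 addr0.
have dij i j : is_derive t 1 (fun s => c (al * s + be) i j)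
    (al * derive1 c (al * t + be) i j).
  have H := @is_derive1_comp _ (fun s => c s i j) (fun s => al * s + be) t _ _
    (is_derive_coord i j dc) dphi.
  by apply: (is_derive_eq H); rewrite mulrC.
rewrite derive_mx; last first.
  by apply/derivable_mxP => i j; have [] := dij i j.
by apply/matrixP => i j; rewrite !mxE; have [] := dij i j.
Qed.

Lemma sqrt_riem_metricZ a (k : R) (u : 'M[R]_(n, m)) :
  Num.sqrt (riem_metric a (k *: u) (k *: u)) = `|k| * Num.sqrt (riem_metric a u u).
Proof.
rewrite /riem_metric linearZ /= -!scalemxAl -scalemxAr !mxtraceZ mulrA -expr2 -mulrA.
by rewrite sqrtrM ?sqr_ge0// sqrtr_sqr.
Qed.

Lemma length_affine_le c c' (al be x y : R) : al != 0 -> smooth_pieces c 0 1 ->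
  (forall t, t \in `]x, y[ -> (al * t + be \in `]0, 1[) /\ c' t = c (al * t + be)) ->
  (\int[lebesgue_measure]_(t in `[x, y]) (speed c' t)%:E <= curve_length c)%E.
Proof.
move=> al0 sc H; have [S dS] := smooth_pieces_derivable sc.
apply: (@le_lower_integral_affine _ al be
  [set` [:: x, y & [seq (s - be) / al | s <- S]]]) => //.
- by apply: finite_set_countable; exact: finite_seq.
- by move=> t _; rewrite lee_fin sqrtr_ge0.
move=> t /= txy /negP; rewrite !inE !negb_or => /and3P[tx ty tS].
have txy' : t \in `]x, y[.
  by move: txy; rewrite !in_itv/= => /andP[xt yt]; rewrite !lt_neqAle eq_sym tx xt ty.
have [t01 c't] := H t txy'; split; first exact: subset_itv_oo_cc t01.
have dc : derivable c (al * t + be) 1.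
  apply: dS => //; apply: contra tS => tS; apply/mapP; exists (al * t + be) => //.
  by field.
have cn : \forall s \near t, c' s = c (al * s + be).
  have : nbhs t `]x, y[%classic by apply: open_nbhs_nbhs; split => //; exact: itv_open.
  by apply: filterS => s /H[].
by rewrite -EFinM lee_fin /speed (derive1_affine dc cn) c't sqrt_riem_metricZ.
Qed.

Lemma admissible_smooth_pieces c a b : admissible_curve a b c ->
  smooth_pieces c 0 1.
Proof. by case=> /piecewise_differentiableP. Qed.

Lemma admissible_reverse a b c : admissible_curve a b c ->
  exists2 c', admissible_curve b a c' & (curve_length c' <= curve_length c)%E.
Proof.
move=> ac; have sc := admissible_smooth_pieces ac; case: ac => _ rc c0 c1.
have N1 : -1 != 0 :> R by rewrite oppr_eq0 oner_eq0.
exists (fun t => c (-1 * t + 1)); last first.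
  apply: (length_affine_le N1 sc) => t; rewrite !in_itv/= => /andP[t0 t1]; split=> //.
  by rewrite mulN1r addrC subr_gt0 t1 ltrBlDr ltrDl.
split.
- apply/piecewise_differentiableP.
  have := smooth_pieces_affine (c' := fun t => c (-1 * t + 1))
    (be := 1) N1 sc (fun=> fun=> erefl).
  rewrite ltNge oppr_le0 ler01/= subrr mul0r sub0r divff//.
- move=> t; rewrite in_itv/= => /andP[t0 t1]; apply: rc.
  by rewrite in_itv/= mulN1r addrC subr_ge0 t1 lerBlDr lerDl.
- by rewrite mulr0 add0r.
- by rewrite mulr1 addNr.
Qed.

Lemma admissible_concat a b e c1 c2 : admissible_curve a b c1 -> admissible_curve b e c2 ->
  exists2 c, admissible_curve a e c &
    (curve_length c <= curve_length c1 + curve_length c2)%E.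
Proof.
move=> ac1 ac2; have sc1 := admissible_smooth_pieces ac1;
  have sc2 := admissible_smooth_pieces ac2.
case: ac1 => _ rc1 c10 c11; case: ac2 => _ rc2 c20 c21.
have n2 : 2 != 0 :> R by [].
pose c t := if t <= 1 / 2 then c1 (2 * t + 0) else c2 (2 * t + -1).
have cl t : t <= 1 / 2 -> c t = c1 (2 * t + 0) by rewrite /c => ->.
have cr t : 1 / 2 <= t -> c t = c2 (2 * t + -1).
  rewrite le_eqVlt /c => /predU1P[<-|]; last by rewrite ltNge => /negbTE ->.
  by rewrite lexx addr0 div1r divff// subrr c11 c20.
exists c.
  split.
  - apply/piecewise_differentiableP; apply: (@join_pieces _ _ _ _ (1 / 2)).
      have := smooth_pieces_affine (c' := c) (be := 0) n2 sc1.
      rewrite ltr0n/= !subr0 mul0r; apply => t; rewrite in_itv/= => /andP[_ t1].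
      by rewrite cl//; lra.
    have := smooth_pieces_affine (c' := c) (be := -1) n2 sc2.
    rewrite ltr0n/= opprK add0r -[1 + 1]/(2) divff//; apply => t;
      rewrite in_itv/= => /andP[t0 _].
    by rewrite cr//; lra.
  - move=> t; rewrite in_itv/= => /andP[t0 t1].
    have [th|/ltW th] := leP t (1 / 2).
      by rewrite cl//; apply: rc1; rewrite in_itv/=; lra.
    by rewrite cr//; apply: rc2; rewrite in_itv/=; lra.
  - by rewrite cl ?mulr0 ?addr0//; lra.
  - by rewrite cr ?mulr1; [rewrite (_ : 2 + -1 = 1)//|]; lra.
have -> : curve_length c = (\int[lebesgue_measure]_(t in
  `[0%R, (1 / 2)%R] `|` `[(1 / 2)%R, 1%R]) (speed c t)%:E)%E.
  rewrite /curve_length; congr (integral _ _ _); apply/seteqP; split=> t /=;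
    rewrite !in_itv/=.
    by move=> /andP[-> ->]; rewrite andbT; have [|/ltW] := leP t (1 / 2); [left|right].
  by move=> [/andP[? ?]|/andP[? ?]]; lra.
have f0 t : (0 <= (speed c t)%:E)%E by rewrite lee_fin sqrtr_ge0.
have mI : measurable (`[0, 1 / 2]%classic : set (measurableTypeR R))
  by exact: measurable_itv.
have := @lower_integral_setU_le _ _ _ lebesgue_measure `[0, 1 / 2]%classic
  `[1 / 2, 1]%classic (fun t => (speed c t)%:E) mI (fun t _ => f0 t).
move=> /le_trans; apply.
apply: leeD.
  apply: (length_affine_le (be := 0) n2 sc1) => t; rewrite !in_itv/= => /andP[t0 t1].
  by split; [lra|rewrite cl// ltW].
apply: (length_affine_le (be := -1) n2 sc2) => t; rewrite !in_itv/= => /andP[t0 t1].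
by split; [lra|rewrite cr// ltW].
Qed.

End CurveOperations.

Section SpecialCurves.
Context {R : realType} {n m : nat}.
Implicit Types (c : R -> 'M[R]_(n, m)) (a b u : 'M[R]_(n, m)).

Lemma curve_length_le c (K : R) : {in `[0, 1], forall t, speed c t <= K} ->
  (curve_length c <= K%:E)%E.
Proof.
move=> cK.
have -> : K%:E = (\int[lebesgue_measure]_(t in `[0%R, 1%R]) cst K%:E t)%E.
  by rewrite integral_cst//= lebesgue_measure_itv/= lte_fin ltr01 -EFinD subr0 mule1.
apply: ge0_le_lower_integral => t; first by rewrite lee_fin sqrtr_ge0.
by move=> t01; rewrite lee_fin; exact: cK.
Qed.

Lemma gramZ (lam : R) a : gram (lam *: a) = lam ^+ 2 *: gram a.
Proof. by rewrite /gram [(_ *: _)^T]linearZ/= -scalemxAl -scalemxAr scalerA. Qed.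

Lemma rank_scale (lam : R) a : lam != 0 -> \rank a = m -> \rank (lam *: a)%R = m.
Proof. by move=> l0 ra; rewrite mxrank_scale_nz. Qed.

Lemma lifted_velocityZ (lam : R) a u : lam != 0 -> \rank a = m ->
  lifted_velocity (lam *: a) (lam *: u) = lifted_velocity a u.
Proof.
move=> l0 ra; have := gram_unit (rank_scale l0 ra).
rewrite /lifted_velocity gramZ => ug; rewrite invmxZ// [(_ *: _)^T]linearZ/=.
rewrite -!scalemxAl -!scalemxAr -scalemxAl !scalerA.
by rewrite (_ : _ * _ = 1) ?scale1r//; field.
Qed.

Lemma quartic_volumeZ (lam : R) a : 0 <= lam ->
  quartic_volume (lam *: a) = Num.sqrt (lam ^+ m) * quartic_volume a.
Proof.
move=> l0; rewrite /quartic_volume gramZ detZ -exprM mulnC exprM.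
rewrite sqrtrM ?sqr_ge0// sqrtr_sqr ger0_norm ?exprn_ge0// sqrtrM// exprn_ge0//.
Qed.

Lemma sqrt_riem_metric_scale (lam : R) a u : 0 < lam -> \rank a = m ->
  Num.sqrt (riem_metric (lam *: a) (lam *: u) (lam *: u)) =
  Num.sqrt (lam ^+ m) * Num.sqrt (riem_metric a u u).
Proof.
move=> l0 ra; have ln0 : lam != 0 by rewrite gt_eqF.
rewrite !speedE//; last exact: rank_scale.
by rewrite lifted_velocityZ// quartic_volumeZ ?ltW// mulrCA.
Qed.

Lemma smooth_piecesZ (lam : R) c x y : smooth_pieces c x y ->
  smooth_pieces (fun t => lam *: c t) x y.
Proof.
elim=> {x y} [x y b xy cb db|x z y _ IH1 _ IH2]; last exact: join_pieces IH1 IH2.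
apply: (@one_piece _ _ _ _ _ (fun t => lam *: b t)); first exact: xy.
  by move=> t txy; rewrite cb.
by move=> t txy; apply: derivableZ; exact: db.
Qed.

(** The metric is homogeneous of degree [m] under scaling. *)
Lemma admissible_scale (lam : R) a b c : 0 < lam -> admissible_curve a b c ->
  exists2 c', admissible_curve (lam *: a) (lam *: b) c' &
    (curve_length c' <= (Num.sqrt (lam ^+ m))%:E * curve_length c)%E.
Proof.
move=> l0 ac; have sc := admissible_smooth_pieces ac; case: ac => _ rc c0 c1.
have ln0 : lam != 0 by rewrite gt_eqF.
exists (fun t => lam *: c t).
  split; rewrite ?c0 ?c1//.
    by apply/piecewise_differentiableP; exact: smooth_piecesZ.
  by move=> t t01; rewrite rank_scale// rc.
have k0 : 0 < Num.sqrt (lam ^+ m) by rewrite sqrtr_gt0 exprn_gt0.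
have := @lower_integralZl_le _ _ _ lebesgue_measure `[0, 1]%classic _ (speed c) k0
  (fun t => sqrtr_ge0 _).
apply: le_trans.
have [S dS] := smooth_pieces_derivable sc.
apply: (@le_lower_integral_affine _ 1 0 [set` [:: 0, 1 & S]]) => //.
- by apply: finite_set_countable; exact: finite_seq.
- by move=> t _; rewrite lee_fin mulr_ge0// sqrtr_ge0.
move=> t /= t01 /negP; rewrite !inE !negb_or => /and3P[tx ty tS].
have t01' : t \in `]0, 1[.
  by move: t01; rewrite !in_itv/= => /andP[? ?]; rewrite !lt_neqAle eq_sym tx ty;
    apply/andP.
rewrite mul1r addr0; split => //; rewrite normr1 mul1e lee_fin.
rewrite derive1E deriveZ; last exact: dS.
by rewrite -derive1E sqrt_riem_metric_scale// rc.
Qed.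

Lemma sqrt_riem_metric_diag a : \rank a = m ->
  Num.sqrt (riem_metric a a a) = Num.sqrt m%:R * quartic_volume a.
Proof.
move=> ra; rewrite speedE//; congr (Num.sqrt _ * _).
by rewrite sqnorm_lifted// mxtrace_mulC mulmxA -/(gram a) mulmxV ?gram_unit// mxtrace1.
Qed.

(** The ray is run at constant speed.  Speed at [lam a] with velocity [lam' a] is
[(lam' / lam) sqrt (lam ^+ m) sqrt m q a], so [lam ^+ m] has to be the square of
an affine function, here [sig], which goes from 1 to [del]. *)
Lemma radial_curve (del : R) a : (0 < m)%N -> 0 < del < 1 -> \rank a = m ->
  exists lam, [/\ 0 < lam, lam ^+ m = del ^+ 2 &
   exists2 c, admissible_curve a (lam *: a) c &
     (curve_length c <= (collapse_radius a)%:E)%E].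
Proof.
move=> m0 /andP[d0 d1] ra.
have mR : 0 < m%:R :> R by rewrite ltr0n.
pose sig t : R := 1 + (del - 1) * t.
pose f t := expR (2 / m%:R * ln (sig t)).
have sig_gt0 (t : R) : t \in `[0, 1] -> 0 < sig t.
  rewrite in_itv/= => /andP[t0 t1]; rewrite /sig.
  have : (1 - del) * t <= 1 - del by rewrite ler_piMr// subr_ge0 ltW.
  lra.
have f_m (t : R) : t \in `[0, 1] -> f t ^+ m = sig t ^+ 2.
  move=> /sig_gt0 st; rewrite /f -expRM_natl mulrA [m%:R * _]mulrC divfK ?gt_eqF//.
  by rewrite expRM_natl lnK.
have df (t : R) : t \in `[0, 1] ->
    is_derive t 1 f (f t * (2 / m%:R * ((sig t)^-1 * (del - 1)))).
  move=> /sig_gt0 st.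
  have ds : is_derive t 1 sig (del - 1).
    have H := is_deriveD (is_derive_cst (1 : R) t 1)
      (is_derive_mul (is_derive_cst (del - 1 : R) t 1) (is_derive_id t 1)).
    by apply: (is_derive_eq H); rewrite mul0r !add0r /cst mulr1.
  have H1 := @is_derive1_comp _ (@ln R) sig t _ _ (is_derive1_ln st) ds.
  have H2 := is_derive_mul (is_derive_cst (2 / m%:R : R) t 1) H1.
  have H3 := @is_derive1_comp _ (@expR R) (fun t => 2 / m%:R * ln (sig t)) t _ _
    (is_derive_expR _) H2.
  by apply: (is_derive_eq H3); rewrite mul0r add0r.
have dc (t : R) : t \in `[0, 1] -> derivable (fun t => f t *: a) t 1.
  move=> t01; apply/derivable_mxP => i j.
  under eq_fun do rewrite mxE.
  have [H _] := is_derive_mul (df t t01) (is_derive_cst (a i j : R) t 1).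
  exact: H.
have c't (t : R) : t \in `[0, 1] -> derive1 (fun t => f t *: a) t =
    (2 / m%:R * ((sig t)^-1 * (del - 1))) *: (f t *: a).
  move=> t01; rewrite derive1E derive_mx; last exact: dc.
  apply/matrixP => i j; rewrite !mxE; under eq_fun do rewrite mxE.
  have [_ ->] := is_derive_mul (df t t01) (is_derive_cst (a i j : R) t 1).
  by rewrite mulr0 addr0 /cst; ring.
exists (f 1); have I01 : (1 : R) \in `[0, 1] by rewrite in_itv/= ler01 lexx.
have I00 : (0 : R) \in `[0, 1] by rewrite in_itv/= ler01 lexx.
split; [exact: expR_gt0|by rewrite f_m// /sig mulr1 addrC subrK|].
exists (fun t => f t *: a).
  split=> //.
  - apply/piecewise_differentiableP;
    apply: (@one_piece _ _ _ _ _ (fun t => f t *: a)) => //.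
  - by move=> t _; rewrite rank_scale// gt_eqF// expR_gt0.
  - by rewrite /f /sig mulr0 addr0 ln1 mulr0 expR0 scale1r.
apply: curve_length_le => t t01; rewrite /speed c't// sqrt_riem_metricZ.
rewrite sqrt_riem_metric_scale ?expR_gt0// sqrt_riem_metric_diag// f_m//.
have st := sig_gt0 t t01.
rewrite sqrtr_sqr (gtr0_norm st) /collapse_radius.
have -> : `|2 / m%:R * ((sig t)^-1 * (del - 1))| = 2 / m%:R * ((sig t)^-1 * (1 - del)).
  rewrite !normrM normfV (ger0_norm (ltW mR)) normfV (gtr0_norm st).
  by rewrite distrC !ger0_norm// subr_ge0 ltW.
have sm : 0 < Num.sqrt (m%:R : R) by rewrite sqrtr_gt0.
have -> : (m%:R : R) = Num.sqrt m%:R ^+ 2 by rewrite sqr_sqrtr// ltW.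
rewrite sqrtr_sqr (gtr0_norm sm).
rewrite [leLHS](_ : _ = (1 - del) * (2 / Num.sqrt m%:R * quartic_volume a)); last first.
  by field; rewrite !gt_eqF.
rewrite ler_piMl//; first by rewrite mulr_ge0 ?quartic_volume_ge0// divr_ge0// ltW.
by rewrite lerBlDr lerDl ltW.
Qed.

(** [tr (g^-1) * vol a], written with the adjugate so that its continuity is
visible; it bounds the Riemannian square norm by the Frobenius one. *)
Definition metric_bound a : R :=
  \tr (\adj (gram a)) / \det (gram a) * Num.sqrt (\det (gram a)).

Lemma riem_metric_le a u : \rank a = m ->
  riem_metric a u u <= metric_bound a * sqnorm u.
Proof.
move=> ra; have ug := gram_unit ra; have D0 := det_gram_gt0 ra.
rewrite /riem_metric -/(gram a) -sqnorm_lifted// /metric_bound mulrAC ler_wpM2r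
  ?sqrtr_ge0//.
rewrite /lifted_velocity -mulmxA.
apply: le_trans (sqnorm_mul_le _ _) _; rewrite mulrC ler_wpM2r ?sqnorm_ge0//.
rewrite /sqnorm trmx_mul trmxK trmx_inv gramT !mulmxA -[_ *m a^T *m a]mulmxA -/(gram a).
by rewrite mulVmx// mul1mx /invmx ug mxtraceZ mulrC.
Qed.

Lemma segment_curve a b (K : R) :
  full_rank_segment a b ->
  (forall t, 0 <= t <= 1 -> metric_bound (a + t *: (b - a)) <= K) ->
  exists2 c, admissible_curve a b c &
    (curve_length c <= (Num.sqrt K * Num.sqrt (sqnorm (b - a)))%:E)%E.
Proof.
move=> rs Kb; pose c t := a + t *: (b - a).
have dc (t : R) : is_derive t 1 c (b - a).
  apply: DeriveDef.
    by apply: derivableD => //; apply/derivable_mxP => i j;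
      under eq_fun do rewrite mxE; apply: derivableM.
  rewrite derive_mx.
    apply/matrixP => i j; rewrite !mxE; under eq_fun do rewrite !mxE.
    have := is_deriveD (is_derive_cst (a i j) t 1) (is_derive_mul (is_derive_id t 1)
      (is_derive_cst ((b - a) i j : R) t 1)).
    by rewrite mul1r mulr0 addr0 add0r /cst !mxE => -[].
  by apply: derivableD => //; apply/derivable_mxP => i j; under eq_fun do rewrite mxE;
    apply: derivableM.
exists c.
  split.
  - apply/piecewise_differentiableP; exact: (@one_piece _ _ _ _ _ c).
  - by move=> t; rewrite in_itv/=; exact: rs.
  - by rewrite /c scale0r addr0.
  - by rewrite /c scale1r addrC subrK.
apply: curve_length_le => t; rewrite in_itv/= => t01.
rewrite /speed derive1E; have [_ ->] := dc t.
have ra := rs t t01.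
have le1 := riem_metric_le (b - a) ra.
rewrite mulrC -sqrtrM ?sqnorm_ge0// ler_wsqrtr// mulrC.
by apply: (le_trans le1); rewrite ler_wpM2r ?sqnorm_ge0// Kb.
Qed.

End SpecialCurves.

(** * The geodesic distance *)

Lemma continuous_inv {R : realType} {T : topologicalType} (f : T -> R) a :
  f a != 0 -> {for a, continuous f} -> {for a, continuous (fun x => (f x)^-1)}.
Proof. by move=> f0 cf; apply: cvgV. Qed.

Lemma near_gt {R : realType} {T : topologicalType} (f : T -> R) a y :
  {for a, continuous f} -> y < f a -> \forall b \near a, y < f b.
Proof. by move=> cf; exact: (cvgr_gt (f a)). Qed.

Lemma near_lt {R : realType} {T : topologicalType} (f : T -> R) a y :
  {for a, continuous f} -> f a < y -> \forall b \near a, f b < y.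
Proof. by move=> cf; exact: (cvgr_lt (f a)). Qed.

Section Distance.
Context {R : realType} {n m : nat}.
Implicit Types (c : R -> 'M[R]_(n, m)) (a b e : 'M[R]_(n, m)).
Notation dist := (@geodesic_dist R n m).

Lemma dist_le_length a b c : admissible_curve a b c -> (dist a b <= curve_length c)%E.
Proof. by move=> ac; apply: ereal_inf_lbound; exists c. Qed.

Lemma dist_lt a b x : (dist a b < x)%E ->
  exists2 c, admissible_curve a b c & (curve_length c < x)%E.
Proof. by move=> /ereal_inf_lt[_ [c ac <-]]; exists c. Qed.

Lemma le_dist a b x : (forall c, admissible_curve a b c -> (x <= curve_length c)%E) ->
  (x <= dist a b)%E.
Proof. by move=> H; apply: le_ereal_inf_tmp => _ [c ac <-]; exact: H. Qed.

Lemma curve_length_ge0 c : (0 <= curve_length c)%E.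
Proof. by apply: integral_ge0 => t _; rewrite lee_fin sqrtr_ge0. Qed.

Lemma dist_ge0 a b : (0 <= dist a b)%E.
Proof. by apply: le_dist => c _; exact: curve_length_ge0. Qed.

Lemma dist_sym a b : dist a b = dist b a.
Proof.
suff H x y : (dist x y <= dist y x)%E by apply/le_anti; rewrite !H.
apply: le_dist => c /admissible_reverse[c' /dist_le_length]; exact: le_trans.
Qed.

Lemma dist_triangle a b e : (dist a e <= dist a b + dist b e)%E.
Proof.
have [->|ab] := eqVneq (dist a b) +oo%E.
  by rewrite addye ?leey// gt_eqF// (lt_le_trans _ (dist_ge0 _ _)).
have [->|be] := eqVneq (dist b e) +oo%E.
  by rewrite addey ?leey// gt_eqF// (lt_le_trans _ (dist_ge0 _ _)).
have fab : dist a b \is a fin_num by rewrite ge0_fin_numE ?dist_ge0// ltey.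
have fbe : dist b e \is a fin_num by rewrite ge0_fin_numE ?dist_ge0// ltey.
apply/lee_addgt0Pr => x x0.
have x20 : 0 < x / 2 by rewrite divr_gt0.
have [c1 ac1 l1] : exists2 c, admissible_curve a b c &
    (curve_length c < dist a b + (x / 2)%:E)%E.
  by apply: dist_lt; rewrite lteDl.
have [c2 ac2 l2] : exists2 c, admissible_curve b e c &
    (curve_length c < dist b e + (x / 2)%:E)%E.
  by apply: dist_lt; rewrite lteDl.
have [c ac lc] := admissible_concat ac1 ac2.
apply: (le_trans (dist_le_length ac)); apply: (le_trans lc).
apply: (le_trans (leeD (ltW l1) (ltW l2))).
by rewrite addeACA -EFinD -splitr.
Qed.

Lemma distxx a : \rank a = m -> dist a a = 0%E.
Proof.
move=> ra; apply/le_anti; rewrite dist_ge0 andbT.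
have [||c /dist_le_length] := @segment_curve _ _ _ a a (metric_bound a).
- by move=> t _; rewrite subrr scaler0 addr0.
- by move=> t _; rewrite subrr scaler0 addr0.
by rewrite subrr /sqnorm mul0mx mxtrace0 sqrtr0 mulr0; exact: le_trans.
Qed.

Lemma collapse_radius_lipschitz a b :
  (`|collapse_radius b - collapse_radius a|%:E <= dist a b)%E.
Proof.
apply: le_dist => c ac; have [_ rc _ c1] := ac.
have I1 : (1 : R) \in `[0, 1] by rewrite in_itv/= ler01 lexx.
rewrite -c1; apply: (curve_increment_le ac _ _ I1).
  by move=> t _; exact: continuous_collapse_radius.
move=> t t01 dc; apply: is_derive_collapse_radius => //.
by apply: rc; exact: subset_itv_oo_cc.
Qed.

Lemma dist_scale (lam : R) a b : 0 < lam ->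
  (dist (lam *: a) (lam *: b) <= (Num.sqrt (lam ^+ m))%:E * dist a b)%E.
Proof.
move=> l0; have s0 : 0 < Num.sqrt (lam ^+ m) by rewrite sqrtr_gt0 exprn_gt0.
rewrite -lee_pdivrMl//; apply: le_dist => c /(admissible_scale l0)[c' /dist_le_length
  H1 H2].
by rewrite lee_pdivrMl// (le_trans H1).
Qed.

(** Full rank is the open condition [0 < det (a^T a)]. *)
Lemma full_rank_nbhs a : \rank a = m -> \forall b \near a, \rank b = m.
Proof.
move=> ra; have := near_gt (@continuous_det_gram R n m a) (det_gram_gt0 ra).
apply: filterS => b Db; apply/eqP; rewrite eqn_leq rank_leq_col leqNgt/=.
by apply/negP => /det_gram_eq0 D0; move: Db; rewrite D0 ltxx.
Qed.

Lemma continuous_metric_bound a : \rank a = m -> {for a, continuous (@metric_bound R n m)}.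
Proof.
move=> ra; have D0 := det_gram_gt0 ra.
apply: continuousM.
  apply: continuousM; last first.
    by apply: (continuous_inv (f := fun b => \det (gram b)));
      [rewrite gt_eqF|exact: continuous_det_gram].
  apply: (continuous_bigsum (f := fun i b => \adj (gram b) i i)) => i.
  by apply: continuous_adj => i' j'; exact: continuous_gram.
by apply: continuous_comp; [exact: continuous_det_gram|exact: sqrt_continuous].
Qed.

(** The straight segment to a nearby matrix is short, as [metric_bound] is bounded
near [a]. *)
Lemma dist_near a (eps : R) : \rank a = m -> 0 < eps ->
  \forall b \near a, (dist a b < eps%:E)%E.
Proof.
move=> ra e0; set K := metric_bound a + 1.
have /nbhs_ballP[r /= r0 Hr] : \forall b \near a, \rank b = m /\ metric_bound b < K.
  near=> b; split; first by near: b; exact: full_rank_nbhs.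
  near: b; apply: (near_lt (continuous_metric_bound ra)).
  by rewrite ltrDl.
have K1 : 0 < 1 + Num.sqrt K by rewrite ltr_pwDl// sqrtr_ge0.
have e1 : 0 < (eps / (1 + Num.sqrt K)) ^+ 2 by rewrite exprn_gt0// divr_gt0.
near=> b.
have ab : ball a r b by near: b; exact: nbhsx_ballx.
have abt t : 0 <= t <= 1 -> ball a r (a + t *: (b - a)).
  move=> /andP[t0 t1]; move: ab; rewrite -ball_normE /= opprD addrA subrr sub0r normrN.
  rewrite distrC => ab; rewrite normrZ ger0_norm//; apply: le_lt_trans ab.
  by rewrite ler_piMl.
have [||c /dist_le_length dab lc] := @segment_curve _ _ _ a b K.
- by move=> t /abt/Hr[].
- by move=> t /abt/Hr[_ /ltW].
apply: (le_lt_trans dab); apply: (le_lt_trans lc); rewrite lte_fin.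
have sb : sqnorm (b - a) < (eps / (1 + Num.sqrt K)) ^+ 2.
  near: b.
  have cs : {for a, continuous (fun b => sqnorm (b - a))}.
    apply: (@continuous_comp _ _ _ (fun b => b - a) (@sqnorm R n m));
      last exact: continuous_sqnorm.
    by apply: continuousB; [exact: cvg_id|exact: cst_continuous].
  by apply: (near_lt cs); rewrite subrr /sqnorm mul0mx mxtrace0.
have : Num.sqrt (sqnorm (b - a)) < eps / (1 + Num.sqrt K).
  have p0 : 0 <= eps / (1 + Num.sqrt K) by rewrite divr_ge0// ltW.
  by rewrite -[ltRHS](ger0_norm p0) -sqrtr_sqr ltr_sqrt.
rewrite ltr_pdivlMr// mulrC; apply: le_lt_trans.
by rewrite ler_wpM2r ?sqrtr_ge0// lerDr.
Unshelve. all: by end_near. Qed.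

(** The full-rank segments produced by [connect_full_rank] have finite length since
[metric_bound] is continuous, hence bounded, on each of them. *)
Lemma dist_lty (mn : (m < n)%N) a b : \rank a = m -> \rank b = m -> (dist a b < +oo)%E.
Proof.
apply: (connect_full_rank (P := fun a b => (dist a b < +oo)%E)) => // {a b}.
  move=> a b e ab be; apply: (le_lt_trans (dist_triangle a b e)).
  by rewrite lte_add_pinfty.
move=> a b rab.
have ci : {within `[0, 1], continuous (fun t : R => metric_bound (a + t *: (b - a)))}.
  apply/subspace_continuousP => t /=; rewrite in_itv/= => t01.
  apply: cvg_within_filter.
  have rt := rab t t01.
  apply: (@continuous_comp _ _ _ (fun t : R => a + t *: (b - a))
    (@metric_bound R n m)); last exact: continuous_metric_bound.
  by apply: continuousD; [exact: cvg_cst|apply: cvgZr_tmp; exact: cvg_id].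
have [t _ tmax] := EVT_max (@ler01 R) ci.
have [//||c /dist_le_length dab lc] :=
  @segment_curve _ _ _ a b (metric_bound (a + t *: (b - a))).
  by move=> s s01; apply: tmax; rewrite in_itv.
by apply: (le_lt_trans dab); apply: (le_lt_trans lc); rewrite ltry.
Qed.

End Distance.

Section Distance2.
Context {R : realType} {n m : nat}.
Implicit Types (c : R -> 'M[R]_(n, m)) (a b e : 'M[R]_(n, m)).
Notation dist := (@geodesic_dist R n m).

(** Down one ray to scale [lam], across, and up the other ray; the middle part is
at most [del * dist a b], which is made smaller than any [x]. *)
Lemma dist_le_radius (mn : (m < n)%N) (m0 : (0 < m)%N) a b :
  \rank a = m -> \rank b = m ->
  (dist a b <= (collapse_radius a + collapse_radius b)%:E)%E.
Proof.
move=> ra rb; have abf := dist_lty mn ra rb.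
have dfin : dist a b \is a fin_num by rewrite ge0_fin_numE ?dist_ge0.
set L := fine (dist a b).
have L0 : 0 <= L by rewrite fine_ge0// dist_ge0.
apply/lee_addgt0Pr => x x0.
pose del := Num.min (1 / 2) (x / (L + 1)).
have L1 : 0 < L + 1 by rewrite ltr_wpDl.
have del01 : 0 < del < 1.
  by rewrite lt_min gt_min !divr_gt0//= ltr_pdivrMr// mul1r ltr1n.
have [lam [l0 lm [c1 ac1 lc1]]] := radial_curve m0 del01 ra.
have [lam' [l'0 l'm [c2 ac2 lc2]]] := radial_curve m0 del01 rb.
have ll' : lam' = lam.
  by apply/eqP; rewrite -(eqrXn2 m0 (ltW l'0) (ltW l0)) lm l'm.
move: ac2; rewrite ll' => ac2.
apply: le_trans (dist_triangle a (lam *: b) b) _.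
rewrite EFinD addeAC.
apply: leeD; last by rewrite dist_sym (le_trans (dist_le_length ac2)).
apply: le_trans (dist_triangle a (lam *: a) (lam *: b)) _.
apply: leeD; first exact: le_trans (dist_le_length ac1) lc1.
apply: (le_trans (dist_scale a b l0)).
case/andP: del01 => d0 _.
rewrite lm sqrtr_sqr gtr0_norm// -(fineK dfin) -EFinM lee_fin -/L.
apply: (@le_trans _ _ (x / (L + 1) * L)).
  by rewrite ler_wpM2r// ge_min lexx orbT.
by rewrite mulrAC ler_pdivrMr// ler_pM2l// lerDl.
Qed.

(** A curve too short to reach the collapsed point keeps its volume bounded below,
because [collapse_radius] is 1-Lipschitz, and then stays bounded. *)
Lemma curve_bounds (m0 : (0 < m)%N) a b c (L q0 : R) : admissible_curve a b c ->
  (curve_length c <= L%:E)%E -> 0 < q0 ->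
  2 / Num.sqrt m%:R * q0 + L <= collapse_radius a ->
  {in `[0, 1], forall t, q0 <= quartic_volume (c t) /\
     1 + sqnorm (c t) <= (1 + sqnorm a) * expR (2 * L / q0)}.
Proof.
move=> ac cL q00 aL.
have sm : 0 < Num.sqrt (m%:R : R) by rewrite sqrtr_gt0 ltr0n.
have qc t : t \in `[0, 1] -> q0 <= quartic_volume (c t).
  move=> t01; have := curve_increment_le ac
    (fun t _ => @continuous_collapse_radius R n m (c t)) _ t01.
  have [_ rc _ _] := ac.
  move=> /(_ (fun t t01 dc => is_derive_collapse_radius dc (rc t (subset_itv_oo_cc t01)))).
  move=> /le_trans/(_ cL); rewrite lee_fin => /ler_normlP[H _].
  have : 2 / Num.sqrt m%:R * q0 <= collapse_radius (c t) by lra.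
  by rewrite /collapse_radius ler_pM2l// divr_gt0.
move=> t t01; split; first exact: qc.
have [_ rc _ _] := ac.
have q2 : 0 < q0 / 2 by rewrite divr_gt0.
have N1 (u : 'M[R]_(n, m)) : 0 < 1 + sqnorm u by rewrite ltr_pwDl// sqnorm_ge0.
have := @curve_increment_le _ _ _ c a b (fun u => q0 / 2 * ln (1 + sqnorm u)) ac _ _ t t01.
move=> /(_ _ _)/le_trans H.
have {H} : (`|q0 / 2 * ln (1 + sqnorm (c t)) - q0 / 2 * ln (1 + sqnorm a)|%:E <= L%:E)%E.
  apply: H cL.
  - move=> s s01; apply: continuous_scale => u.
    apply: (@continuous_comp _ _ _ (fun u => 1 + sqnorm u) (@ln R));
      last exact: continuous_ln.
    by apply: continuousD; [exact: cst_continuous|exact: continuous_sqnorm].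
  - move=> s s01 ds; apply: is_derive_ln_sqnorm => //.
      by apply: rc; exact: subset_itv_oo_cc.
    by rewrite ltW//= qc//; exact: subset_itv_oo_cc.
rewrite lee_fin => /ler_normlP[_].
rewrite -mulrBr -ler_pdivlMl// lerBlDl => H.
rewrite -ler_ln ?posrE ?mulr_gt0 ?expR_gt0// lnM ?posrE ?expR_gt0// expRK.
by apply: (le_trans H); rewrite lerD2l [leLHS](_ : _ = 2 * L / q0)//; field; rewrite gt_eqF.
Qed.

Lemma collapse_radius_gt0 (m0 : (0 < m)%N) a : \rank a = m -> 0 < collapse_radius a.
Proof.
by move=> ra; rewrite mulr_gt0 ?quartic_volume_gt0// divr_gt0// sqrtr_gt0 ltr0n.
Qed.

(** Curves of length at most a quarter of [rho a], issued from points that close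
to [a], keep [rho] above half of [rho a].  On them the entries have derivative
at most [X / q0] times the speed, where [X ^+ 2] bounds the square norm.  The
radius depends on [a] only through [rho a], which is what lets one point of a
Cauchy filter serve for all small scales. *)
Lemma local_coord_bound (m0 : (0 < m)%N) a : \rank a = m ->
  exists2 C : R, 0 < C & forall b e (L : R),
    (dist a b < (collapse_radius a / 4)%:E)%E -> (dist b e < L%:E)%E ->
    L <= collapse_radius a / 4 -> forall i j, `|e i j - b i j| <= C * L.
Proof.
(* k * q0 is half of rho a *)
move=> ra; pose q0 := quartic_volume a / 2; pose k : R := 2 / Num.sqrt m%:R.
have q00 : 0 < q0 by rewrite divr_gt0// quartic_volume_gt0.
have k0 : 0 < k by rewrite divr_gt0// sqrtr_gt0 ltr0n.
have aE : collapse_radius a = 2 * (k * q0) by rewrite /collapse_radius -/k /q0; field.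
pose r := collapse_radius a / 4.
have rE : r = k * q0 / 2 by rewrite /r aE; field.
have r0 : 0 < r by rewrite rE divr_gt0// mulr_gt0.
pose E := expR (2 * r / q0).
have N1 (u : 'M[R]_(n, m)) : 1 <= 1 + sqnorm u by rewrite lerDl sqnorm_ge0.
have E1 : 1 <= E.
  by rewrite -expR0 ler_expR ltW// divr_gt0// mulr_gt0.
pose X := (1 + sqnorm a) * E * E.
have X1 : 1 <= X by rewrite !mulr_ege1.
have X0 : 0 < X by exact: lt_le_trans X1.
exists (X / q0); first by rewrite divr_gt0.
rewrite -/r => b e L dab dbe Lr i j.
have [c1 ac1 lc1] := dist_lt dab.
have [c2 ac2 lc2] := dist_lt dbe.
have I1 : (1 : R) \in `[0, 1] by rewrite in_itv/= ler01 lexx.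
have ra' : k * q0 + r <= collapse_radius a by rewrite rE aE; nra.
have [_] := curve_bounds m0 ac1 (ltW lc1) q00 ra' I1.
have [_ _ _ c11] := ac1; rewrite c11 -/E => bE.
have rhob : k * q0 + L <= collapse_radius b.
  have := le_lt_trans (collapse_radius_lipschitz a b) dab.
  rewrite lte_fin => /ltr_normlP[H _]; move: H; rewrite aE rE in Lr *; nra.
have cb := curve_bounds m0 ac2 (ltW lc2) q00 rhob.
have X_le t : t \in `[0, 1] -> sqnorm (c2 t) <= X ^+ 2.
  move=> t01; have [_ H] := cb t t01.
  have EL : expR (2 * L / q0) <= E by rewrite ler_expR ler_pM2r ?invr_gt0// ler_pM2l.
  have : 1 + sqnorm (c2 t) <= X.
    apply: (le_trans H); apply: ler_pM => //.
    by rewrite (le_trans ler01)// N1.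
  have XX : X <= X ^+ 2 by rewrite expr2 ler_peMr// ltW.
  by move=> H2; apply: le_trans XX; apply: le_trans H2; rewrite lerDr.
have := @curve_increment_le _ _ _ c2 b e (fun u => q0 / X * u i j) ac2 _ _ 1 I1.
have [_ rc _ c21] := ac2; rewrite c21.
move=> /(_ _ _)/le_trans H.
have {H} : (`|q0 / X * e i j - q0 / X * b i j|%:E <= L%:E)%E.
  apply: H (ltW lc2).
  - by move=> s s01; apply: continuous_scale; exact: coord_continuous.
  - move=> s s01 ds; have s01' := subset_itv_oo_cc s01.
    apply: is_derive_coord_le => //; [exact: rc| |exact: X_le].
    by have [-> _] := cb s s01'; rewrite ltW.
rewrite lee_fin -mulrBr normrM ger0_norm; last by rewrite divr_ge0// ltW.
rewrite -ler_pdivlMl; last by rewrite divr_gt0.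
by rewrite invf_div.
Qed.

Lemma dist_separated (m0 : (0 < m)%N) a b : \rank a = m -> dist a b = 0%E -> a = b.
Proof.
move=> ra d0; have [C C0 H] := local_coord_bound m0 ra.
pose r := collapse_radius a / 4.
have r0 : 0 < r by rewrite divr_gt0// collapse_radius_gt0.
apply/matrixP => i j; apply/esym/eqP; rewrite -subr_eq0 -normr_le0.
apply/ler_addgt0Pr => x x0; rewrite add0r.
pose L := Num.min r (x / C).
have L0 : 0 < L by rewrite lt_min r0 divr_gt0.
apply: (le_trans (H a b L _ _ _ i j)).
- by rewrite distxx// lte_fin.
- by rewrite d0 lte_fin.
- by rewrite ge_min lexx.
by rewrite -ler_pdivlMl// mulrC ge_min lexx orbT.
Qed.

End Distance2.

(** * The metric on the quotient and its completeness *)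

Section CollapsedMetric.
Context {R : realType} {n m : nat} (mn : (m < n)%N).
Implicit Types (a b e : 'M[R]_(n, m)).
Notation dist := (@geodesic_dist R n m).
Notation rho := (@collapse_radius R n m).

(** The radius is 0 at singular matrices, so the second branch is the distance to
the collapsed point, or 0 if both matrices are singular. *)
Definition collapsed_dist a b : R :=
  if (\rank a == m) && (\rank b == m) then fine (dist a b) else `|rho a - rho b|.

Lemma full_rank_leq a : (\rank a == m) = (m <= \rank a)%N.
Proof. by rewrite eqn_leq rank_leq_col. Qed.

Lemma dist_fin a b : \rank a == m -> \rank b == m -> dist a b \is a fin_num.
Proof. by move=> /eqP ra /eqP rb; rewrite ge0_fin_numE ?dist_ge0// dist_lty. Qed.

Lemma collapsed_distE a b : \rank a == m -> \rank b == m ->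
  (collapsed_dist a b)%:E = dist a b.
Proof. by move=> ra rb; rewrite /collapsed_dist ra rb fineK// dist_fin. Qed.

Lemma rho_singular a : (\rank a == m) = false -> rho a = 0.
Proof.
by rewrite full_rank_leq leqNgt => /negbFE ra;
  rewrite /collapse_radius quartic_volume_eq0 ?mulr0.
Qed.

Lemma rho_ge0 a : 0 <= rho a.
Proof. by rewrite mulr_ge0 ?quartic_volume_ge0// divr_ge0// sqrtr_ge0. Qed.

Lemma collapsed_dist_sym a b : collapsed_dist a b = collapsed_dist b a.
Proof. by rewrite /collapsed_dist andbC distrC dist_sym. Qed.

Lemma rho_collapsed_le a b : `|rho a - rho b| <= collapsed_dist a b.
Proof.
rewrite /collapsed_dist; case: ifP => // /andP[ra rb].
by rewrite -lee_fin fineK ?dist_fin// distrC collapse_radius_lipschitz.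
Qed.

Lemma collapsed_dist_le_rho a b : (0 < m)%N -> collapsed_dist a b <= rho a + rho b.
Proof.
move=> m0; rewrite /collapsed_dist; case: ifP => [/andP[ra rb]|_].
  by rewrite -lee_fin fineK ?dist_fin// dist_le_radius//; exact/eqP.
by rewrite (le_trans (ler_normB _ _))// !ger0_norm ?rho_ge0.
Qed.

Lemma collapsed_distxx a : collapsed_dist a a = 0.
Proof.
by rewrite /collapsed_dist subrr normr0; case: ifP => // /andP[/eqP ra _]; rewrite distxx.
Qed.

(** If one end point is singular, use that the radius is 1-Lipschitz; if only the
middle point is, use that the distance is at most the sum of the radii. *)
Lemma collapsed_dist_triangle b a e :
  collapsed_dist a e <= collapsed_dist a b + collapsed_dist b e.
Proof.
have H x y : collapsed_dist x y = `|rho x - rho y| ->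
    collapsed_dist x y <= collapsed_dist x b + collapsed_dist b y.
  move=> ->; apply: le_trans (ler_distD (rho b) _ _) _.
  by apply: lerD; exact: rho_collapsed_le.
have [ra|ra] := boolP (\rank a == m); last by apply: H; rewrite /collapsed_dist (negPf ra).
have [re|re] := boolP (\rank e == m); last by apply: H;
  rewrite /collapsed_dist (negPf re) andbF.
have [rb|rb] := boolP (\rank b == m).
  by rewrite -lee_fin EFinD !collapsed_distE// dist_triangle.
have m0 : (0 < m)%N.
  by move: rb; rewrite full_rank_leq -ltnNge; exact: leq_ltn_trans.
apply: (le_trans (collapsed_dist_le_rho a e m0)).
rewrite {1 2}/collapsed_dist (negPf rb) andbF/= (rho_singular (negPf rb)).
by rewrite subr0 sub0r normrN lerD// ler_norm.
Qed.

Lemma collapsed_dist_eq0 a b : collapsed_dist a b = 0 -> collapse a b.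
Proof.
rewrite /collapsed_dist /collapse; case: ifP => [/andP[ra rb] d0|].
  have [m0|m0] := posnP m; first by apply/orP; left; apply/eqP/matrixP => i j;
    have := ltn_ord j; rewrite {2}m0.
  suff -> : a = b by rewrite eqxx.
  by apply: (dist_separated m0 (eqP ra)); rewrite -(fineK (dist_fin ra rb)) d0.
have [ra /= rb|ra] := boolP (\rank a == m).
  have m0 : (0 < m)%N.
    by move/negbT: rb; rewrite full_rank_leq -ltnNge; exact: leq_ltn_trans.
  rewrite (rho_singular rb) subr0 => /normr0_eq0 a0.
  by have := collapse_radius_gt0 m0 (eqP ra); rewrite a0 ltxx.
have sa : (\rank a < m)%N by rewrite ltnNge -full_rank_leq.
have m0 : (0 < m)%N by exact: leq_ltn_trans sa.
move=> _; rewrite (rho_singular (negPf ra)) sub0r normrN => /normr0_eq0 b0.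
have [rb|rb] := boolP (\rank b == m).
  by have := collapse_radius_gt0 m0 (eqP rb); rewrite b0 ltxx.
by rewrite sa/= ltnNge -full_rank_leq rb orbT.
Qed.

Local Open Scope quotient_scope.

Lemma collapse_repr a : collapse (repr (\pi_(collapsed_mx R n m) a)) a.
Proof. by have /eqmodP := reprK (\pi_(collapsed_mx R n m) a). Qed.

Lemma repr_full_rank a : \rank a == m -> repr (\pi_(collapsed_mx R n m) a) = a.
Proof.
move=> ra; have /orP[/eqP//|/andP[_]] := collapse_repr a.
by rewrite (eqP ra) ltnn.
Qed.

(** A copy of the quotient indexed by the proof of [m < n], which its metric
structure depends on. *)
Definition completed_mx (_ : (m < n)%N) := collapsed_mx R n m.
HB.instance Definition _ := Choice.on (completed_mx mn).

Let mdistC (x y : completed_mx mn) : R := collapsed_dist (repr x) (repr y).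
Let mdistCxx x : mdistC x x = 0. Proof. exact: collapsed_distxx. Qed.
Let mdistC_eq0 x y : mdistC x y = 0 -> x = y.
Proof.
by move=> /collapsed_dist_eq0 H; rewrite -[x]reprK -[y]reprK; apply/eqmodP.
Qed.
Let mdistC_sym x y : mdistC x y = mdistC y x.
Proof. exact: collapsed_dist_sym. Qed.
Let mdistC_triangle y x z : mdistC x z <= mdistC x y + mdistC y z.
Proof. exact: collapsed_dist_triangle. Qed.

HB.instance Definition _ := isMetric.Build R (completed_mx mn)
  mdistCxx mdistC_eq0 mdistC_sym mdistC_triangle.

Lemma mdistE (x y : completed_mx mn) : mdist x y = collapsed_dist (repr x) (repr y).
Proof. by []. Qed.

(** Scaling a full-rank matrix down makes its radius, that is, its distance to the
collapsed point, arbitrarily small. *)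
Lemma dense_full_rank_class :
  dense (range (full_rank_class : full_rank_mx R n m -> completed_mx mn)).
Proof.
move=> O [x Ox] oO.
have [rx|rx] := boolP (\rank (repr x) == m).
  exists x; split=> //; exists (exist _ (repr x) rx) => //.
  by rewrite /full_rank_class /= reprK.
have m0 : (0 < m)%N by move: rx; rewrite full_rank_leq -ltnNge; exact: leq_ltn_trans.
have /nbhs_ballP[eps /= e0 xO] : nbhs x O by exact: open_nbhs_nbhs.
pose a : 'M[R]_(n, m) := pid_mx m.
have ra : \rank a = m by rewrite rank_pid_mx// ltnW.
have r0 := collapse_radius_gt0 m0 ra.
pose del := Num.min (1 / 2) (eps / (2 * rho a)).
have del01 : 0 < del < 1.
  have e2 : 0 < eps / (2 * rho a) by rewrite divr_gt0// mulr_gt0.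
  by rewrite lt_min gt_min e2 !divr_gt0//= ltr_pdivrMr// mul1r ltr1n.
have [lam [l0 lm _]] := radial_curve m0 del01 ra.
have rl : \rank (lam *: a)%R == m by rewrite rank_scale// gt_eqF.
exists (full_rank_class (exist _ (lam *: a) rl)); split;
  last by exists (exist _ (lam *: a) rl).
apply: xO; rewrite ballEmdist/= mdistE repr_full_rank//.
rewrite /collapsed_dist (negPf rx)/= (rho_singular (negPf rx)) sub0r normrN ger0_norm
  ?rho_ge0//.
rewrite /collapse_radius quartic_volumeZ ?ltW// lm sqrtr_sqr gtr0_norm;
  last by case/andP: del01.
rewrite mulrCA -/(rho a); apply: (@le_lt_trans _ _ (eps / (2 * rho a) * rho a)).
  by rewrite ler_wpM2r ?rho_ge0// ge_min lexx orbT.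
by rewrite (_ : _ * _ = eps / 2); [rewrite ltr_pdivrMr// ltr_pMr// ltr1n|field;
  rewrite gt_eqF].
Qed.

(** Either the radius tends to 0 along the filter and the limit is the collapsed
point [s], or the filter has an element where the radius exceeds some [r > 0].
In the second case entries of representatives form a Cauchy filter [G] by
[local_coord_bound]; its limit has positive radius, hence full rank. *)
Lemma completed_mx_complete : complete_space (completed_mx mn).
Proof.
move=> F FF /cauchyP Fc.
have [m0|m0] := posnP m.
  (* for m = 0 there is a single matrix *)
  exists (\pi_(collapsed_mx R n m) 0); apply/cvg_ballP => eps e0; apply: nearW => x.
  have -> : x = \pi_(collapsed_mx R n m) 0; last exact: ballxx.
  rewrite -[x]reprK; congr (\pi_(_) _); apply/matrixP => i j.
  by have := ltn_ord j; rewrite {2}m0.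
pose s : completed_mx mn := \pi_(collapsed_mx R n m) 0.
have rs : (\rank (repr s) == m) = false.
  apply/negbTE; rewrite full_rank_leq -ltnNge.
  by have /orP[/eqP->|/andP[]//] := collapse_repr 0; rewrite mxrank0.
have [toS|] := pselect (forall eps : R, 0 < eps -> F [set x | rho (repr x) < eps]).
  exists s; apply/cvg_ballP => eps e0; apply: filterS (toS _ e0) => x xe.
  by rewrite ballEmdist/= mdistE /collapsed_dist rs (rho_singular rs) sub0r normrN
    ger0_norm ?rho_ge0.
move=> /existsNP[e0 /not_implyP[e00 nF]].
have e80 : 0 < e0 / 8 by rewrite divr_gt0.
have [x0 Fx0] := Fc _ e80.
have rho_ball (x y : completed_mx mn) eps : ball x eps y ->
    rho (repr x) - eps < rho (repr y).
  rewrite ballEmdist/= mdistE => xy.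
  by have := le_lt_trans (rho_collapsed_le _ _) xy => /ltr_normlP[]; lra.
(* a smaller radius at x0 would put its whole ball below e0 *)
have rho_x0 : 7 / 8 * e0 <= rho (repr x0).
  rewrite leNgt; apply/negP => x0_lt; apply: nF;
    apply: filterS Fx0 => y /ball_sym/rho_ball /=.
  lra.
set a := repr x0 in rho_x0.
have ra : \rank a == m.
  by apply/negPn/negP => /negbTE/rho_singular r0; move: rho_x0; rewrite r0; lra.
pose r := rho a / 4.
have r_gt : e0 / 8 < r by rewrite /r; lra.
have r0 : 0 < r by exact: lt_trans r_gt.
have [C C0 HC] := local_coord_bound m0 (eqP ra).
have Fr : F [set y | [/\ \rank (repr y) == m,
  (dist a (repr y) < r%:E)%E & r < rho (repr y)]].
  apply: filterS Fx0 => y yx0; have ry : r < rho (repr y).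
    by have := rho_ball _ _ _ yx0; rewrite -/a /r; lra.
  have fy : \rank (repr y) == m.
    by apply/negPn/negP => /negbTE/rho_singular y0; move: ry; rewrite y0 ltNge (ltW r0).
  split => //; rewrite -collapsed_distE// lte_fin.
  by move: yx0; rewrite ballEmdist/= mdistE => /lt_trans; apply.
pose G := (repr : completed_mx mn -> 'M[R]_(n, m)) @ F.
have GP : ProperFilter G by exact: fmap_proper_filter.
have : cauchy G.
  apply/cauchyP => eps eps0.
  pose L := Num.min r (eps / C / 2).
  have L0 : 0 < L by rewrite lt_min r0 !divr_gt0.
  have L20 : 0 < L / 2 by rewrite divr_gt0.
  have [x1 Fx1] := Fc _ L20.
  have [y0 [[fy0 dy0 _] y0x1]] := filter_ex (filterI Fr Fx1).
  exists (repr y0); rewrite /G nbhs_simpl /=;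
    apply: filterS (filterI Fr Fx1) => y [[fy dy _] yx1].
  split => // i j; rewrite /ball/= distrC.
  have yy0 : (dist (repr y0) (repr y) < L%:E)%E.
    rewrite -collapsed_distE// lte_fin -mdistE.
    by have := ball_splitr y0x1 yx1; rewrite ballEmdist.
  have := HC _ _ L dy0 yy0; rewrite -/r ge_min lexx => /(_ isT i j) /le_lt_trans; apply.
  rewrite -ltr_pdivlMl// mulrC gt_min; apply/orP; right.
  by rewrite ltr_pdivrMr// ltr_pMr ?ltr1n// divr_gt0.
move=> /cauchy_cvg /cvg_ex[/= l Gl].
have rl : \rank l == m.
  apply/negPn/negP => /negbTE/rho_singular l0.
  have : \forall b \near l, rho b < r
    by apply: (near_lt (@continuous_collapse_radius R n m l)); rewrite l0.
  move=> /Gl; rewrite /G nbhs_simpl/= => Fl.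
  have [y [/= yr [_ _ /lt_trans/(_ yr)]]] := filter_ex (filterI Fl Fr).
  by rewrite ltxx.
exists (\pi_(collapsed_mx R n m) l); apply/cvg_ballP => eps eps0.
have /Gl := dist_near (eqP rl) eps0; rewrite /G nbhs_simpl/= => Fl.
apply: filterS (filterI Fl Fr) => y [/= dly [fy _ _]].
by rewrite ballEmdist/= mdistE repr_full_rank// -lte_fin collapsed_distE.
Qed.

End CollapsedMetric.

Theorem theorem3p13 (R : realType) (n m : nat) (hnm : (m < n)%N) :
  exists c : Metric R (collapsed_mx R n m),
    is_metric_completion
      (fun a b : full_rank_mx R n m => geodesic_dist (val a) (val b))
      (full_rank_class : full_rank_mx R n m -> Metric.Pack c).
Proof.
exists (Metric.class (completed_mx hnm)); split.
- move=> x y; rewrite (mdistE (mn := hnm) (full_rank_class x) (full_rank_class y)).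
  rewrite !repr_full_rank ?(valP x) ?(valP y)//.
  by rewrite collapsed_distE// ?(valP x) ?(valP y).
- exact: dense_full_rank_class.
- exact: completed_mx_complete.
Qed.
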